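(* Let $M\subset\mathbb{C}^{n+1}$ ($n\geq1$) be a strictly pseudoconvex real hypersurface defined by $\varrho=0$, where $\varrho$ is a smooth real-valued function with $d\varrho\neq0$ on $M$. Suppose that $\varrho_{j\bar k}=a_{j\bar k}+o(\varrho)$ along $M$, where $[a_{j\bar k}]$ is a positive definite Hermitian matrix of constants. Let $\theta=\iota^*(i\bar\partial\varrho)$, where $\iota\colon M\to\mathbb{C}^{n+1}$ is the inclusion. Then $(M,\theta)$ is a semi-isometric real hypersurface in $\mathbb{C}^{n+1}$ equipped with the Hermitian metric $a_{j\bar k}dz^j\otimes d\bar z^k$, i.e. $d\theta=\iota^*\omega$ with $\omega=ia_{j\bar k}dz^j\wedge d\bar z^k$. Moreover, the following are equivalent: (1) $M$ is $\mathbb{C}$-convex; (2) $(M,\theta)$ is pseudohermitian $\mathbb{C}$-convex in $(\mathbb{C}^{n+1},a_{j\bar k}dz^j\otimes d\bar z^k)$.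
   Context: Here $\varrho_j=\partial\varrho/\partial z_j$, $\varrho_{jk}=\partial^2\varrho/\partial z_j\partial z_k$, $\varrho_{j\bar k}=\partial^2\varrho/\partial z_j\partial\bar z_k$. The notation $\varrho_{j\bar k}=a_{j\bar k}+o(\varrho)$ along $M$ means that $(\varrho_{j\bar k}-a_{j\bar k})/\varrho\to0$ as one approaches $M$ (in particular $\varrho_{j\bar k}=a_{j\bar k}$ on $M$). $M$ is $\mathbb{C}$-convex if the Hessian $$\mathrm{Hess}_\varrho(p;\eta)=\sum_{j,k}\mathrm{Re}\,(\varrho_{jk}(p)\eta_j\eta_k)+\sum_{j,k}\varrho_{j\bar k}(p)\eta_j\overline{\eta_k}$$ is $\geq0$ for every $p\in M$ and every $\eta\in\mathbb{C}^{n+1}$ with $\sum_j\varrho_j(p)\eta_j=0$ (for boundaries of smoothly bounded domains this differential condition characterizes $\mathbb{C}$-convexity of the domain). Pseudohermitian $\mathbb{C}$-convexity: $T^{(1,0)}(M)=T^{(1,0)}(\mathbb{C}^{n+1})\cap\mathbb{C}T(M)$, $H(M)=\mathrm{Re}\,T^{(1,0)}(M)=\ker\theta$. The Reeb field $T$ satisfies $T\rfloor d\theta=0$, $\theta(T)=1$. For a local frame $Z_\alpha$ ($\alpha=1,\dots,n$) of $T^{(1,0)}(M)$, $Z_{\bar\alpha}=\overline{Z_\alpha}$, with $\{\theta^\alpha,\theta^{\bar\alpha},\theta\}$ dual to $\{Z_\alpha,Z_{\bar\alpha},T\}$, $d\theta=ih_{\alpha\bar\beta}\theta^\alpha\wedge\theta^{\bar\beta}$.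 The Tanaka–Webster connection $\nabla$ is given by $\nabla Z_\alpha=\omega_\alpha{}^\beta Z_\beta$, $\nabla Z_{\bar\alpha}=\omega_{\bar\alpha}{}^{\bar\beta}Z_{\bar\beta}$, $\nabla T=0$, where $d\theta^\beta=\theta^\alpha\wedge\omega_\alpha{}^\beta+A^\beta{}_{\bar\alpha}\theta\wedge\theta^{\bar\alpha}$ and $dh_{\alpha\bar\beta}=\omega_\alpha{}^\gamma h_{\gamma\bar\beta}+h_{\alpha\bar\gamma}\omega_{\bar\beta}{}^{\bar\gamma}$. Let $\widetilde\nabla$ be the (flat) Chern connection of the metric, $\langle\cdot,\cdot\rangle$ the complex bilinear extension with $\langle\partial_j,\partial_{\bar k}\rangle=a_{j\bar k}$, $\langle\partial_j,\partial_k\rangle=0$, and $|V|^2=\langle V,\overline V\rangle$. Put $\mathrm{II}(X,Y)=\widetilde\nabla_XY-\nabla_XY$ for sections $X,Y$ of $\mathbb{C}T(M)$ (suitably extended), $H=\frac1n\sum_{\alpha=1}^n\mathrm{II}(Z_{\bar\alpha},Z_\alpha)$ for a local unitary frame $Z_\alpha$ of $T^{(1,0)}(M)$, $\mu=\frac12(H+\overline H)$, and $h(X,Y)=\langle\mathrm{II}(X,Y),\mu\rangle/|\mu|$ for $X,Y\in H(M)$. $(M,\theta)$ is pseudohermitian $\mathbb{C}$-convex if $h$ is positive semi-definite on $H(M)$. *)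

(* Defs.v *)
From HB Require Import structures.
From mathcomp Require Import all_boot all_order all_algebra complex.
From mathcomp Require Import all_classical all_reals all_analysis.

Set Implicit Arguments.
Unset Strict Implicit.
Unset Printing Implicit Defensive.

Import Order.TTheory GRing.Theory Num.Theory.
Import numFieldNormedType.Exports.

Local Open Scope classical_set_scope.
Local Open Scope ring_scope.
Local Open Scope complex_scope.

(* The point (x, y) of [Cpoint R n] stands for z = x + i y in C^(n+1), seen as
   a real normed space.  The vector (b, c) of [Cvec R n] stands for
   sum_j b_j d/dz_j + sum_j c_j d/d(conj z_j), and, as a covector, for
   sum_j b_j dz_j + sum_j c_j d(conj z_j).  Vector fields and 1-forms are
   functions [Cpoint R n -> Cvec R n]. *)
Notation Cpoint R n := ('rV[R]_n.+1 * 'rV[R]_n.+1)%type.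
Notation Cvec R n := ('rV[R[i]]_n.+1 * 'rV[R[i]]_n.+1)%type.

Section Calculus.
Context {R : realType} {n : nat}.
Implicit Types (f : Cpoint R n -> R[i]) (p : Cpoint R n) (j : 'I_n.+1).

(* C^infinity on an open set W: every iterated directional derivative is
   differentiable at every point of W. *)
Definition smooth_on (W : set (Cpoint R n)) (g : Cpoint R n -> R) : Prop :=
  forall (s : seq (Cpoint R n)) p, W p ->
    differentiable (foldr (fun v (u : Cpoint R n -> R) => 'D_v u) g s) p.

Definition csmooth_on W f : Prop :=
  smooth_on W (fun p => complex.Re (f p)) /\
  smooth_on W (fun p => complex.Im (f p)).

Definition vsmooth_on W (X : Cpoint R n -> Cvec R n) : Prop :=
  forall j, csmooth_on W (fun p => (X p).1 0 j) /\
            csmooth_on W (fun p => (X p).2 0 j).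

Definition cderive (v : Cpoint R n) f p : R[i] :=
  ('D_v (fun q => complex.Re (f q)) p) +i* ('D_v (fun q => complex.Im (f q)) p).

Definition dx_dir j : Cpoint R n := (delta_mx 0 j, 0).
Definition dy_dir j : Cpoint R n := (0, delta_mx 0 j).

Definition dz j f p : R[i] :=
  2^-1 * (cderive (dx_dir j) f p - 'i%C * cderive (dy_dir j) f p).
Definition dzbar j f p : R[i] :=
  2^-1 * (cderive (dx_dir j) f p + 'i%C * cderive (dy_dir j) f p).

Definition vact (X : Cvec R n) f p : R[i] :=
  \sum_j (X.1 0 j * dz j f p + X.2 0 j * dzbar j f p).

(* On vector fields, the flat Chern connection of a constant metric. *)
Definition flatD (X : Cvec R n) (Y : Cpoint R n -> Cvec R n) p : Cvec R n :=
  (\row_j vact X (fun q => (Y q).1 0 j) p,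
   \row_j vact X (fun q => (Y q).2 0 j) p).

Definition conjv (X : Cvec R n) : Cvec R n :=
  (map_mx conjc X.2, map_mx conjc X.1).

Definition form_eval (s X : Cvec R n) : R[i] :=
  \sum_j (s.1 0 j * X.1 0 j + s.2 0 j * X.2 0 j).

Definition wedge_form (s t X Y : Cvec R n) : R[i] :=
  form_eval s X * form_eval t Y - form_eval s Y * form_eval t X.

(* d s (X, Y) = X(s(Y)) - Y(s(X)) - s([X, Y]), computed with X and Y extended
   with constant coefficients. *)
Definition dform (s : Cpoint R n -> Cvec R n) p (X Y : Cvec R n) : R[i] :=
  form_eval (flatD X s p) Y - form_eval (flatD Y s p) X.

End Calculus.

Section Hypersurface.
Context {R : realType} {n : nat}.
Variables (U : set (Cpoint R n)) (rho : Cpoint R n -> R).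
Implicit Types (p : Cpoint R n) (W : set (Cpoint R n)).

Definition rho_ j p : R[i] := dz j (fun q => (rho q)%:C) p.
Definition rhobar_ k p : R[i] := dzbar k (fun q => (rho q)%:C) p.
Definition rho2_ j k p : R[i] := dz j (rho_ k) p.
Definition rho11_ j k p : R[i] := dz j (rhobar_ k) p.

Definition hypersurface : set (Cpoint R n) := U `&` [set p | rho p = 0].

(* The limit is taken off the hypersurface, at each of its points; the
   equality of rho11_ j k with a j k on it is then a consequence. *)
Definition complex_hessian_o (a : 'M[R[i]]_n.+1) : Prop :=
  forall p, hypersurface p -> forall j k,
    (rho11_ j k q - a j k) / (rho q)%:C
      @[q --> within (~` hypersurface) (nbhs p)] --> (0 : (R[i])^o).

Definition CTM p : set (Cvec R n) :=
  [set X : Cvec R n | \sum_j (rho_ j p * X.1 0 j + rhobar_ j p * X.2 0 j) = 0].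
Definition T10M p : set (Cvec R n) := [set X : Cvec R n | CTM p X /\ X.2 = 0].
Definition HM p : set (Cvec R n) :=
  [set X : Cvec R n | exists2 Z, T10M p Z & X = Z + conjv Z].

Definition strictly_pseudoconvex : Prop :=
  forall p, hypersurface p -> forall eta : 'rV[R[i]]_n.+1, eta != 0 ->
    \sum_j rho_ j p * eta 0 j = 0 ->
    0 < \sum_j \sum_k rho11_ j k p * eta 0 j * (eta 0 k)^*%C.

Definition Hess p (eta : 'rV[R[i]]_n.+1) : R[i] :=
  \sum_j \sum_k (complex.Re (rho2_ j k p * eta 0 j * eta 0 k))%:C
  + \sum_j \sum_k rho11_ j k p * eta 0 j * (eta 0 k)^*%C.

Definition C_convex : Prop :=
  forall p, hypersurface p -> forall eta : 'rV[R[i]]_n.+1,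
    \sum_j rho_ j p * eta 0 j = 0 -> 0 <= Hess p eta.

Definition i_dbar_rho p : Cvec R n := (0, \row_k ('i%C * rhobar_ k p)).

(* All forms on the hypersurface M are given by ambient forms: identities
   between them are required on tangent vectors at points of M only. *)
Variable theta : Cpoint R n -> Cvec R n.

Definition kahler_form (a : 'M[R[i]]_n.+1) (X Y : Cvec R n) : R[i] :=
  'i%C * \sum_j \sum_k a j k * (X.1 0 j * Y.2 0 k - Y.1 0 j * X.2 0 k).

Definition semi_isometric (a : 'M[R[i]]_n.+1) : Prop :=
  forall p, hypersurface p -> forall X Y, CTM p X -> CTM p Y ->
    dform theta p X Y = kahler_form a X Y.

Definition is_frame W (Z : 'I_n -> Cpoint R n -> Cvec R n) : Prop :=
  (forall al, vsmooth_on W (Z al)) /\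
  forall p, W p -> hypersurface p ->
    (forall al, T10M p (Z al p)) /\ row_free (\matrix_al (Z al p).1).

Definition is_unitary_frame W (E : 'I_n -> Cpoint R n -> Cvec R n) : Prop :=
  is_frame W E /\
  forall p, W p -> hypersurface p -> forall al be,
    dform theta p (E al p) (conjv (E be p)) = 'i%C * (al == be)%:R.

Definition is_Reeb W (T : Cpoint R n -> Cvec R n) : Prop :=
  vsmooth_on W T /\
  forall p, W p -> hypersurface p ->
    [/\ CTM p (T p), conjv (T p) = T p, form_eval (theta p) (T p) = 1
      & forall X, CTM p X -> dform theta p (T p) X = 0].

(* [tw_omega d al be] is omega_al^be and [tw_A d be al] is A^be_(conj al). *)
Record tw_data := TWData {
  tw_Z : 'I_n -> Cpoint R n -> Cvec R n;
  tw_T : Cpoint R n -> Cvec R n;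
  tw_th : 'I_n -> Cpoint R n -> Cvec R n;
  tw_h : 'I_n -> 'I_n -> Cpoint R n -> R[i];
  tw_omega : 'I_n -> 'I_n -> Cpoint R n -> Cvec R n;
  tw_A : 'I_n -> 'I_n -> Cpoint R n -> R[i] }.

Record is_tanaka_webster W (d : tw_data) : Prop := IsTanakaWebster {
  tw_frameP : is_frame W (tw_Z d);
  tw_ReebP : is_Reeb W (tw_T d);
  tw_th_smooth : forall al, vsmooth_on W (tw_th d al);
  tw_h_smooth : forall al be, csmooth_on W (tw_h d al be);
  tw_omega_smooth : forall al be, vsmooth_on W (tw_omega d al be);
  tw_A_smooth : forall al be, csmooth_on W (tw_A d al be);
  tw_dual : forall p, W p -> hypersurface p -> forall al be,
    [/\ form_eval (tw_th d al p) (tw_Z d be p) = (al == be)%:R,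
        form_eval (tw_th d al p) (conjv (tw_Z d be p)) = 0
      & form_eval (tw_th d al p) (tw_T d p) = 0];
  tw_dtheta : forall p, W p -> hypersurface p ->
    forall X Y, CTM p X -> CTM p Y ->
    dform theta p X Y =
      'i%C * \sum_al \sum_be tw_h d al be p *
             wedge_form (tw_th d al p) (conjv (tw_th d be p)) X Y;
  tw_structure : forall p, W p -> hypersurface p ->
    forall X Y, CTM p X -> CTM p Y -> forall be,
    dform (tw_th d be) p X Y =
      \sum_al wedge_form (tw_th d al p) (tw_omega d al be p) X Y +
      \sum_al tw_A d be al p * wedge_form (theta p) (conjv (tw_th d al p)) X Y;
  tw_metric : forall p, W p -> hypersurface p ->
    forall X, CTM p X -> forall al be,
    vact X (tw_h d al be) p =
      \sum_ga (form_eval (tw_omega d al ga p) X * tw_h d ga be p +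
               tw_h d al ga p * form_eval (conjv (tw_omega d be ga p)) X) }.

(* nabla_X Y for Y = th^al(Y) Z_al + conj(th^al)(Y) conj(Z_al) + theta(Y) T,
   with nabla Z_al = omega_al^be Z_be, its conjugate, and nabla T = 0. *)
Definition tw_nabla (d : tw_data) (X Y : Cpoint R n -> Cvec R n) p : Cvec R n :=
  \sum_al (vact (X p) (fun q => form_eval (tw_th d al q) (Y q)) p
           + \sum_be form_eval (tw_th d be p) (Y p)
                     * form_eval (tw_omega d be al p) (X p)) *: tw_Z d al p
  + \sum_al (vact (X p) (fun q => form_eval (conjv (tw_th d al q)) (Y q)) p
           + \sum_be form_eval (conjv (tw_th d be p)) (Y p)
                     * form_eval (conjv (tw_omega d be al p)) (X p))
        *: conjv (tw_Z d al p)
  + vact (X p) (fun q => form_eval (theta q) (Y q)) p *: tw_T d p.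

Definition second_ff (d : tw_data) (X Y : Cpoint R n -> Cvec R n) p :=
  flatD (X p) Y p - tw_nabla d X Y p.

Definition metric_form (a : 'M[R[i]]_n.+1) (X Y : Cvec R n) : R[i] :=
  \sum_j \sum_k a j k * (X.1 0 j * Y.2 0 k + Y.1 0 j * X.2 0 k).

Definition mean_curv (d : tw_data) (E : 'I_n -> Cpoint R n -> Cvec R n) p :=
  (n%:R^-1 : R[i]) *: \sum_al second_ff d (fun q => conjv (E al q)) (E al) p.

Definition mu_vec d E p : Cvec R n :=
  (2^-1 : R[i]) *: (mean_curv d E p + conjv (mean_curv d E p)).

Definition h_form a d E (X Y : Cpoint R n -> Cvec R n) p : R[i] :=
  metric_form a (second_ff d X Y p) (mu_vec d E p)
    / sqrtC (metric_form a (mu_vec d E p) (conjv (mu_vec d E p))).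

(* The Tanaka-Webster connection, II, H and mu do not depend on the local data
   d and E computing them, and such data exist near every point. *)
Definition pseudohermitian_C_convex (a : 'M[R[i]]_n.+1) : Prop :=
  forall W, open W -> W `<=` U ->
  forall d, is_tanaka_webster W d ->
  forall E, is_unitary_frame W E ->
  forall X, vsmooth_on W X ->
    (forall q, W q -> hypersurface q -> HM q (X q)) ->
  forall p, W p -> hypersurface p -> 0 <= h_form a d E X X p.

End Hypersurface.

(* Main.v *)
Require Import Defs.
From HB Require Import structures.
From mathcomp Require Import all_boot all_order all_algebra complex.
From mathcomp Require Import all_classical all_reals all_analysis.
From mathcomp Require Import ring lra.

Set Implicit Arguments.
Unset Strict Implicit.
Unset Printing Implicit Defensive.

Import Order.TTheory GRing.Theory Num.Theory.
Import numFieldNormedType.Exports.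

Local Open Scope classical_set_scope.
Local Open Scope ring_scope.
Local Open Scope complex_scope.

(** Write [l] for the (1,0) part of [d rho], let [grad l] be its gradient for the
    metric [a], [xi = grad l / |grad l|^2] and [r = |grad l|^-2]. The hypothesis
    on the mixed Hessian says on [M] that it equals [a] ([rho11E]): it is
    continuous, and [M] has empty interior because [d rho <> 0]. So
    [d theta = i ddbar rho] restricts to the Kaehler form ([dtheta_kahler]), and
    the Reeb field is [i xi - i conj xi].

    Both notions of convexity are then compared pointwise. Let [Z] be tangent of
    type (1,0). The structure equation of the Tanaka-Webster connection, read on
    [conj Z'] and [Z], shows that [nabla_(conj Z') Z] is the orthogonal projection
    of the flat derivative to the contact bundle ([II_frame_bar]); compatibility
    with the metric carries this over to [nabla_(Z') Z] ([II_frame_orth]). Hence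
    the second fundamental form takes values in the span of [xi] and [conj xi],
    and differentiating [l (Z) = 0] gives its coefficients ([second_ff1]):
      II (Z', Z) = - rho_jk Z'^j Z^k xi,   II (conj Z', Z) = - <Z, conj Z'> xi.
    In particular the mean curvature is [- xi], so [mu = - (xi + conj xi) / 2],
    and for [X = Z + conj Z] one finds [h (X, X) = r / sqrt (r / 2) * Hess (Z)]
    ([h_formE]), a positive multiple of the Hessian. This proves that C-convexity
    implies pseudohermitian C-convexity.

    For the converse the quantifier over local data must not be void: near each
    point of [M] there must be a Tanaka-Webster connection and a unitary frame.
    A smooth unitary frame is obtained by rotating a fixed orthonormal basis of
    the complex tangent space at the point ([rotate], [local_unitary_frame]), and
    in such a frame the dual coframe, the connection forms and the torsion are
    given by explicit formulas ([unitary_tanaka_webster]).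

    Fields and forms on [M] are given by extensions to an open set, so the
    argument rests on the fact that a derivative in a direction tangent to [M]
    depends only on values on [M] ([tangent_derive_eq0], [vact_tangentM]). *)

(** * Real differential calculus *)

Section RealCalculus.
Context {R : realType} {V : normedModType R}.
Implicit Types (f g rho : V -> R) (p v w : V).

Lemma diff_approx f p (e : R) : differentiable f p -> 0 < e ->
  exists2 d : R, 0 < d & forall h, `|h| < d ->
    `|f (p + h) - f p - 'd f p h| <= e * `|h|.
Proof.
move=> /diff_locally /eqaddoP fP e0.
have /nbhs_normP[d /= d0 dP] := fP e e0.
exists d => // h hd; have := dP h.
rewrite /= sub0r normrN => /(_ hd).
by rewrite !fctE /= opprD addrA [h + p]addrC.
Qed.

Lemma near_eq_differentiable f g p :
  {near p, f =1 g} -> differentiable f p -> differentiable g p.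
Proof.
move=> fg df.
have fgp : f p = g p by exact: nbhs_singleton fg.
have shiftfg : \forall h \near (0 : V), f (h + p) = g (h + p).
  have := fg; rewrite (near_shift 0 p).
  by apply: filterS => h; rewrite /= subr0.
apply/diff_locallyP.
suff H : 'd g p = 'd f p :> (V -> R) /\
     g \o shift p = cst (g p) + 'd f p +o_ 0 id.
  by rewrite H.1; split; [exact: diff_continuous|exact: H.2].
have go : g \o shift p = cst (g p) + 'd f p +o_ 0 id.
  apply/eqaddoP => e e0.
  have /eqaddoP /(_ e e0) := diff_locally df.
  apply: filterS2 shiftfg => h /= fgh.
  by rewrite !fctE /= fgh fgp.
split; last exact: go.
by apply: diff_unique => //; exact: diff_continuous.
Qed.

(** A displacement [t *: v] tangent to the level set of [rho] can be corrected, by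
    the intermediate value theorem, to one that stays in the level set, at the
    cost of an error at most [e * t] along a transversal direction [w]. *)
Lemma tangent_derive_eq0 rho f p v w :
  differentiable f p -> (\forall q \near p, differentiable rho q) ->
  rho p = 0 -> (\forall q \near p, rho q = 0 -> f q = 0) ->
  'd rho p w != 0 -> 'd rho p v = 0 -> 'd f p v = 0.
Proof.
move=> df drho rp0 fz rw0 rv0.
wlog rw1 : w {rw0} / 'd rho p w = 1.
  move=> /(_ (('d rho p w)^-1 *: w)); apply.
  by rewrite linearZ /= /GRing.scale /= mulVf.
apply/eqP; apply: contraT => fv0.
set L := `|'d f p v|; set Lw := `|'d f p w|.
have L0 : 0 < L by rewrite normr_gt0.
(* [e] makes the error caused by the correction along [w] at most [L / 4]. *)
pose e := Num.min 1 (L / (4 * (Lw + 1))).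
have Lw0 : 0 <= Lw by rewrite normr_ge0.
have e0 : 0 < e by rewrite lt_min ltr01 divr_gt0// mulr_gt0// ltr_wpDl.
have e1 : e <= 1 by rewrite ge_min lexx.
have eLw : e * Lw <= L / 4.
  have : e <= L / (4 * (Lw + 1)) by rewrite ge_min lexx orbT.
  rewrite ler_pdivlMr; last by rewrite mulr_gt0// ltr_wpDl.
  rewrite mulrCA mulrDr mulr1 => H; rewrite ler_pdivlMr// mulrC.
  by apply: le_trans H; rewrite ler_pM2l// lerDl ltW.
set N := `|v| + `|w| + 1.
have N0 : 0 < N by rewrite ltr_wpDl// addr_ge0.
have drp : differentiable rho p by exact: nbhs_singleton drho.
have eN0 : 0 < e / (2 * N) by rewrite divr_gt0// mulr_gt0.
have LN0 : 0 < L / (4 * N) by rewrite divr_gt0// mulr_gt0.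
have [d1 d10 rP] := diff_approx drp eN0.
have [d2 d20 fP] := diff_approx df LN0.
have /nbhs_normP[d3 /= d30 d3P] := drho.
have /nbhs_normP[d4 /= d40 d4P] := fz.
pose d := Num.min (Num.min d1 d2) (Num.min d3 d4).
have d0 : 0 < d by rewrite !lt_min d10 d20 d30 d40.
pose t := d / (2 * N).
have t0 : 0 < t by rewrite divr_gt0// mulr_gt0.
have tN : t * N < d.
  rewrite /t mulrAC ltr_pdivrMr ?mulr_gt0// ltr_pM2l// mulr_natl mulr2n.
  by rewrite ltrDl.
pose h s := t *: (v + s *: w).
have hN s : `|s| <= e -> `|h s| <= t * N.
  move=> se; rewrite /h normrZ gtr0_norm// ler_pM2l//.
  rewrite (le_trans (ler_normD _ _))// /N -addrA lerD2l normrZ.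
  rewrite ler_wpDr// ler_piMl// (le_trans se)//.
have hd s : `|s| <= e -> [/\ `|h s| < d1, `|h s| < d2, `|h s| < d3 & `|h s| < d4].
  move=> /hN se; have : `|h s| < d by rewrite (le_lt_trans se).
  by rewrite !lt_min => /andP[/andP[-> ->] /andP[-> ->]].
have dh (g : V -> R) s : 'd g p (h s) = t * ('d g p v + s * 'd g p w).
  by rewrite /h linearZ /= linearD linearZ.
have rh s : `|s| <= e -> `|rho (p + h s) - t * s| <= t * e / 2.
  move=> se; have [h1 _ _ _] := hd _ se.
  have := rP _ h1; rewrite rp0 subr0 dh rv0 rw1 add0r mulr1 => /le_trans; apply.
  have := hN _ se; rewrite -(ler_pM2l eN0) => /le_trans; apply.
  rewrite le_eqVlt; apply/orP; left; apply/eqP; field.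
  by rewrite gt_eqF.
(* [rho] is negative at [p + h (- e)] and positive at [p + h e]. *)
have [s se rs] : exists2 s, `|s| <= e & rho (p + h s) = 0.
  have cont : {within `[-e, e], continuous (fun s => rho (p + h s))}.
    apply: continuous_in_subspaceT => s; rewrite inE /= in_itv /= => sI.
    have se : `|s| <= e by rewrite ler_norml.
    apply: (@continuous_comp _ _ _ (fun s => p + h s) rho).
      apply: continuousD; first exact: cst_continuous.
      apply: (@cvgZl_tmp _ _ _ _ _ t (fun s => v + s *: w)).
      apply: (@cvgD _ _ _ _ _ (fun=> v) (fun s => s *: w)); first exact: cvg_cst.
      exact: scalel_continuous.
    apply: differentiable_continuous.
    apply: d3P => /=; rewrite opprD addNKr normrN.
    by have [] := hd _ se.
  have ee : `|e| <= e by rewrite gtr0_norm.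
  have := rh _ ee; have := rh (- e).
  rewrite normrN => /(_ ee); rewrite !ler_norml mulrN opprK => /andP[_ A] /andP[B _].
  have te : 0 < t * e by rewrite mulr_gt0.
  have [||s sI sE] := @IVT R (fun s => rho (p + h s)) (- e) e 0 _ cont.
    - by rewrite ge0_cp// ltW.
    - rewrite ge_min le_max; apply/andP; split; apply/orP; [left|right].
        by move: A te; clear; move: (rho _) => x; lra.
      by move: B te; clear; move: (rho _) => x; lra.
  by exists s => //; move: sI; rewrite in_itv /= ler_norml.
have [_ h2 _ h4] := hd _ se.
have fs : f (p + h s) = 0.
  by apply: d4P rs => /=; rewrite opprD addNKr normrN.
have fp0 : f p = 0 by exact: (nbhs_singleton fz).
have := fP _ h2; rewrite fs fp0 subrr sub0r normrN dh normrM gtr0_norm//.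
have : L / (4 * N) * `|h s| <= t * (L / 4).
  have := hN _ se; rewrite -(ler_pM2l LN0) => /le_trans; apply.
  rewrite le_eqVlt; apply/orP; left; apply/eqP; field.
  by rewrite gt_eqF.
move=> A B; have := le_trans B A; rewrite ler_pM2l// => {A B}.
have := lerB_normD ('d f p v) (s * 'd f p w).
rewrite normrM -/L -/Lw.
have : `|s| * Lw <= L / 4 by rewrite (le_trans _ eLw)// ler_wpM2r.
move=> A B C; move: (le_trans B C) A L0; clear; move: (`|s| * Lw) => x.
by clearbody L => H1 H2 H3; exfalso; lra.
Qed.

Lemma quotient_estimate (A B a x y e t : R) : 0 < t ->
  `|B - a - x| <= e / 2 * t -> `|A - a - (x + t * y)| <= e / 2 * t ->
  `|(A - B) * t - t ^+ 2 * y| <= e * t ^+ 2.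
Proof.
move=> t0 H1 H2; have -> : (A - B) * t - t ^+ 2 * y
    = t * ((A - a - (x + t * y)) - (B - a - x)) by ring.
rewrite normrM gtr0_norm// expr2 mulrCA ler_pM2l//.
by rewrite (le_trans (ler_normB _ _))// (le_trans (lerD H2 H1))// -mulrDl -splitr.
Qed.

(** By the mean value theorem along [u], the second difference of [g] along [t *: u]
    and [t *: v] is [t] times an increment of [D_u g], that is [t ^ 2 D_v D_u g] up
    to [o (t ^ 2)]. It is symmetric in [u] and [v], whence [derive_comm]. *)
Lemma second_difference (g : V -> R) p u v (e : R) :
  (\forall q \near p, differentiable g q) ->
  differentiable ('D_u g) p -> 0 < e ->
  exists2 d : R, 0 < d & forall t : R, 0 < t -> t < d ->
   `|g (p + t *: u + t *: v) - g (p + t *: u) - g (p + t *: v) + g p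
     - t ^+ 2 * 'D_v ('D_u g) p| <= e * t ^+ 2.
Proof.
move=> dg dDg e0; rewrite deriveE//.
set N : R := 2 * (`|u| + `|v|) + 1.
have N0 : 0 < N by rewrite ltr_wpDl// mulr_ge0// addr_ge0.
have eN0 : 0 < e / (2 * N) by rewrite divr_gt0// mulr_gt0.
have [d1 d10 DP] := diff_approx dDg eN0.
have /nbhs_normP[d2 /= d20 d2P] := dg.
pose d := Num.min d1 d2.
have d0 : 0 < d by rewrite lt_min d10 d20.
exists (d / N); first by rewrite divr_gt0.
move=> t t0; rewrite ltr_pdivlMr// => td.
have hN (s r : R) : 0 <= s <= t -> 0 <= r <= t -> `|s *: u + r *: v| <= t * N.
  move=> /andP[s0 st] /andP[r0 rt]; rewrite (le_trans (ler_normD _ _))// !normrZ.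
  rewrite !ger0_norm// /N.
  have : s * `|u| <= t * `|u| by rewrite ler_wpM2r.
  have : r * `|v| <= t * `|v| by rewrite ler_wpM2r.
  have := mulr_ge0 (ltW t0) (normr_ge0 u).
  have := mulr_ge0 (ltW t0) (normr_ge0 v); clear -t0; move: `|u| `|v| => a b.
  by move=> *; lra.
have hd (s r : R) : 0 <= s <= t -> 0 <= r <= t ->
    `|s *: u + r *: v| < d1 /\ `|s *: u + r *: v| < d2.
  move=> s0 r0; have : `|s *: u + r *: v| < d.
    by rewrite (le_lt_trans (hN _ _ s0 r0)).
  by rewrite lt_min => /andP[].
have difg (s r : R) : 0 <= s <= t -> 0 <= r <= t ->
    differentiable g (p + (s *: u + r *: v)).
  move=> s0 r0; apply: d2P => /=; rewrite opprD addNKr normrN.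
  by have [] := hd _ _ s0 r0.
have tt : 0 <= t <= t by rewrite lexx ltW.
have t00 : 0 <= (0 : R) <= t by apply/andP; split; [|exact: ltW].
have isd (s r : R) : 0 <= s <= t -> 0 <= r <= t ->
    is_derive s 1 (fun s : R => g (p + (s *: u + r *: v)))
      ('D_u g (p + (s *: u + r *: v))).
  move=> s0 r0; have dd := difg _ _ s0 r0.
  have EF : (fun h : R => h^-1 *: (g (p + ((h *: 1 + s) *: u + r *: v))
                                   - g (p + (s *: u + r *: v)))) =
      (fun h : R => h^-1 *: (g (h *: u + (p + (s *: u + r *: v)))
                             - g (p + (s *: u + r *: v)))).
    apply/funext => h; congr (h^-1 *: (g _ - _)).
    by rewrite [h%:A]mulr1 scalerDl -addrA (addrCA p).
  apply: DeriveDef; last exact: (congr1 (fun F => lim (F @ 0^')) EF).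
  have : cvg ((fun h : R => h^-1 *: (g (h *: u + (p + (s *: u + r *: v)))
                  - g (p + (s *: u + r *: v)))) @ 0^') by exact: diff_derivable.
  by rewrite -EF.
(* The mean value theorem along [u] for the increment of [g] along [v]. *)
pose phi (s : R) := g (p + (s *: u + t *: v)) - g (p + (s *: u + 0 *: v)).
pose dphi (s : R) := 'D_u g (p + (s *: u + t *: v)) - 'D_u g (p + (s *: u + 0 *: v)).
have dphiP (s : R) : 0 <= s <= t -> is_derive s 1 phi (dphi s).
  by move=> s0; apply: is_deriveB; apply: isd.
have phic : {within `[0, t], continuous phi}.
  apply: derivable_within_continuous => s; rewrite in_itv /= => sI.
  by have [] := dphiP s sI.
have phid s : s \in `]0, t[ -> is_derive s 1 phi (dphi s).
  by rewrite in_itv /= => /andP[/ltW ? /ltW ?]; apply: dphiP; apply/andP.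
have [c] := MVT t0 phid phic.
rewrite in_itv /= => /andP[/ltW c0 /ltW ct]; rewrite subr0 => phiE.
have cI : 0 <= c <= t by rewrite c0.
have -> : g (p + t *: u + t *: v) - g (p + t *: u) - g (p + t *: v) + g p
    = dphi c * t.
  rewrite -phiE /phi !scale0r !(add0r, addr0) !addrA; ring.
have [h1 _] := hd _ _ cI tt.
have [h2 _] := hd _ _ cI t00.
have := DP _ h1; have := DP _ h2.
have dL (s : R) : 'd ('D_u g) p (c *: u + s *: v)
    = c * 'd ('D_u g) p u + s * 'd ('D_u g) p v.
  by rewrite linearD !linearZ.
have EN x : x <= t * N -> e / (2 * N) * x <= e / 2 * t.
  rewrite -(ler_pM2l eN0) => /le_trans; apply.
  rewrite le_eqVlt; apply/orP; left; apply/eqP; field.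
  by rewrite gt_eqF.
rewrite !dL mul0r addr0 => HA HB.
have := le_trans HB (EN _ (hN _ _ cI tt)).
have := le_trans HA (EN _ (hN _ _ cI t00)).
exact: quotient_estimate.
Qed.

Lemma derive_comm (g : V -> R) p u v :
  (\forall q \near p, differentiable g q) ->
  differentiable ('D_u g) p -> differentiable ('D_v g) p ->
  'D_v ('D_u g) p = 'D_u ('D_v g) p.
Proof.
move=> dg du dv.
have A e e0 := second_difference v dg du (e := e) e0.
have B e e0 := second_difference u dg dv (e := e) e0.
move: ('D_v ('D_u g) p) ('D_u ('D_v g) p) A B => a b A B.
apply/eqP; rewrite -subr_eq0; apply: contraT => ab0.
have e0 : 0 < `|a - b| / 4 by rewrite divr_gt0// normr_gt0.
have [d1 d10 P1] := A _ e0.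
have [d2 d20 P2] := B _ e0.
pose t := Num.min d1 d2 / 2.
have m0 : 0 < Num.min d1 d2 by rewrite lt_min d10.
have t0 : 0 < t by rewrite divr_gt0.
have : t < Num.min d1 d2 by rewrite /t ltr_pdivrMr// mulr_natr mulr2n ltrDl.
rewrite lt_min => /andP[t1 t2].
have := P2 _ t0 t2; have := P1 _ t0 t1.
have -> : p + t *: u + t *: v = p + t *: v + t *: u by rewrite addrAC.
rewrite [in X in _ -> X -> _](addrAC _ (- g (p + t *: v))).
move: (_ + g p) => D; rewrite [in X in X -> _]distrC => D1 D2.
have := le_trans (ler_distD D _ _) (lerD D1 D2).
have t20 : 0 < t ^+ 2 by rewrite exprn_gt0.
rewrite -mulrBr normrM (gtr0_norm t20) -mulrDl [leRHS]mulrC ler_pM2l//.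
rewrite -mulrDl -mulr2n -mulr_natl => H.
have : 0 < `|a - b| by rewrite normr_gt0.
by move: H; clear; move: `|a - b| => x *; exfalso; lra.
Qed.

End RealCalculus.

(** * Complex numbers and smooth functions *)

Section ComplexNumbers.
Context {R : realType}.

Lemma halfC : (2^-1 : R[i]) = (2^-1)%:C.
Proof. by rewrite fmorphV rmorph_nat. Qed.

Lemma Re_mul (x y : R[i]) : complex.Re (x * y) =
  complex.Re x * complex.Re y - complex.Im x * complex.Im y.
Proof. by case: x; case: y. Qed.
Lemma Im_mul (x y : R[i]) : complex.Im (x * y) =
  complex.Re x * complex.Im y + complex.Im x * complex.Re y.
Proof. by case: x; case: y. Qed.
Lemma Re_add (x y : R[i]) : complex.Re (x + y) = complex.Re x + complex.Re y.
Proof. by case: x; case: y. Qed.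
Lemma Im_add (x y : R[i]) : complex.Im (x + y) = complex.Im x + complex.Im y.
Proof. by case: x; case: y. Qed.

Lemma conjc_mul (x y : R[i]) : (x * y)^*%C = x^*%C * y^*%C.
Proof. exact: rmorphM. Qed.

Lemma conjc_sub (x y : R[i]) : (x - y)^*%C = x^*%C - y^*%C.
Proof. exact: rmorphB. Qed.

Lemma conjc_add (x y : R[i]) : (x + y)^*%C = x^*%C + y^*%C.
Proof. exact: rmorphD. Qed.

Lemma ii_mul : 'i%C * 'i%C = -1 :> R[i].
Proof. by rewrite -expr2 sqr_i. Qed.

Lemma conji : ('i%C : R[i])^*%C = - 'i%C.
Proof. by apply/eqP; rewrite eq_complex /= oppr0 !eqxx. Qed.

Lemma i_neq0 : 'i%C != 0 :> R[i].
Proof. by rewrite eq_complex /= oner_eq0 andbF. Qed.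

Lemma Re_gt0 (z : R[i]) : 0 < z -> 0 < complex.Re z.
Proof. by rewrite ltcE => /andP[]. Qed.

End ComplexNumbers.

Section RealSmooth.
Context {R : realType} {n : nat}.
Variable W : set (Cpoint R n).
Hypothesis Wo : open W.
Implicit Types (f g : Cpoint R n -> R) (p v : Cpoint R n).

Lemma smooth_differentiable g p : smooth_on W g -> W p -> differentiable g p.
Proof. by move=> /(_ [::] p). Qed.

Lemma smooth_derive g v : smooth_on W g -> smooth_on W ('D_v g).
Proof. by move=> gs s p Wp; have := gs (rcons s v) p Wp; rewrite foldr_rcons. Qed.

Lemma near_open p (P : Cpoint R n -> Prop) :
  W p -> (forall q, W q -> P q) -> \forall q \near p, P q.
Proof. by move=> Wp WP; apply: filterS WP _; exact: open_nbhs_nbhs. Qed.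

(** Counting orders of differentiability turns closure under products, inverses
    and square roots into an induction: a derivative of such an expression is
    built from the same expression, of lower order, and derivatives of the given
    functions. *)
Fixpoint diff_upto k g : Prop :=
  (forall p, W p -> differentiable g p) /\
  (if k is k'.+1 then forall v, diff_upto k' ('D_v g) else True).

Lemma smooth_uptoP g : smooth_on W g <-> forall k, diff_upto k g.
Proof.
split=> [gs k|].
  elim: k g gs => [|k IH] g gs; split=> //; try by move=> p; exact: smooth_differentiable.
  by move=> v; apply: IH; exact: smooth_derive.
move=> + s; elim/last_ind: s g => [|s v IH] g gk p Wp.
  by have [+ _] := gk 0%N; apply.
by rewrite foldr_rcons; apply: IH => // k; have [_ +] := gk k.+1; apply.
Qed.

Lemma diff_upto_diff k g p : diff_upto k g -> W p -> differentiable g p.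
Proof. by case: k => [|k] [+ _]; apply. Qed.

Lemma diff_uptoW k g : diff_upto k.+1 g -> diff_upto k g.
Proof.
elim: k g => [|k IH] g [g1 g2]; split=> // v.
by apply: IH; exact: g2.
Qed.

Lemma diff_upto_ext k f g :
  (forall q, W q -> f q = g q) -> diff_upto k f -> diff_upto k g.
Proof.
elim: k f g => [|k IH] f g fg [f1 f2]; split=> //.
- by move=> p Wp; apply: near_eq_differentiable (f1 p Wp); exact: near_open.
- by move=> p Wp; apply: near_eq_differentiable (f1 p Wp); exact: near_open.
- move=> v; apply: IH (f2 v) => q Wq.
  by apply: near_eq_derive; exact: near_open.
Qed.

Lemma diff_upto_cst k (c : R) : diff_upto k (fun=> c).
Proof.
elim: k c => [|k IH] c; split=> // v.
apply: diff_upto_ext (IH 0) => q _.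
by rewrite (derive_cst c).
Qed.

Lemma diff_uptoD k f g :
  diff_upto k f -> diff_upto k g -> diff_upto k (fun q => f q + g q).
Proof.
elim: k f g => [|k IH] f g [f1 f2] [g1 g2].
  by split=> // p Wp; exact: differentiableD (f1 p Wp) (g1 p Wp).
split=> [p Wp|v]; first exact: differentiableD (f1 p Wp) (g1 p Wp).
apply: diff_upto_ext (IH _ _ (f2 v) (g2 v)) => q Wq.
by rewrite [RHS](@deriveD _ _ _ f g)//; apply: diff_derivable; [exact: f1|exact: g1].
Qed.

Lemma diff_uptoM k f g :
  diff_upto k f -> diff_upto k g -> diff_upto k (fun q => f q * g q).
Proof.
elim: k f g => [|k IH] f g fk gk.
  split=> // p Wp; exact: (@differentiableM _ _ f g _ (diff_upto_diff fk Wp) (diff_upto_diff gk Wp)).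
have [f1 f2] := fk; have [g1 g2] := gk; split=> [p Wp|v].
  exact: (@differentiableM _ _ f g _ (f1 p Wp) (g1 p Wp)).
have := diff_uptoD (IH _ _ (diff_uptoW fk) (g2 v)) (IH _ _ (diff_uptoW gk) (f2 v)).
apply: diff_upto_ext => q Wq.
by rewrite [RHS](@deriveM _ _ f g)//; apply: diff_derivable; [exact: f1|exact: g1].
Qed.

Lemma diff_uptoV k f : (forall q, W q -> f q != 0) ->
  diff_upto k f -> diff_upto k (fun q => (f q)^-1).
Proof.
move=> fn0; elim: k => [|k IH] fk.
  by split=> // p Wp; apply: differentiableV; [exact: diff_upto_diff fk Wp|exact: fn0].
have [f1 f2] := fk; split=> [p Wp|v].
  by apply: differentiableV; [exact: f1|exact: fn0].
have iv := IH (diff_uptoW fk).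
have := diff_uptoM (diff_upto_cst k (-1)) (diff_uptoM (diff_uptoM iv iv) (f2 v)).
apply: diff_upto_ext => q Wq.
rewrite [RHS](@deriveV _ _ f)//; [|exact: fn0|by apply: diff_derivable; exact: f1].
by rewrite /GRing.scale /= mulN1r mulNr expr2 invfM.
Qed.

Lemma diff_upto_sqrt k f : (forall q, W q -> 0 < f q) ->
  diff_upto k f -> diff_upto k (fun q => Num.sqrt (f q)).
Proof.
move=> f0.
have dsqrt p : W p -> differentiable f p -> differentiable (Num.sqrt \o f) p.
  move=> Wp df; apply: differentiable_comp => //.
  by apply/derivable1_diffP; have [] := is_derive1_sqrt (f0 p Wp).
elim: k => [|k IH] fk.
  by split=> // p Wp; apply: dsqrt => //; exact: diff_upto_diff fk Wp.
have [f1 f2] := fk; split=> [p Wp|v]; first exact: dsqrt (f1 p Wp).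
have sq := IH (diff_uptoW fk).
have sqn0 q : W q -> 2 * Num.sqrt (f q) != 0.
  by move=> Wq; rewrite mulf_neq0// gt_eqF// sqrtr_gt0 f0.
have := diff_uptoM (f2 v) (diff_uptoV sqn0 (diff_uptoM (diff_upto_cst k 2) sq)).
apply: diff_upto_ext => q Wq.
have ds : differentiable Num.sqrt (f q).
  by apply/derivable1_diffP; have [] := is_derive1_sqrt (f0 q Wq).
rewrite [RHS](deriveE v (dsqrt q Wq (f1 q Wq))) (diff_comp (f1 q Wq) ds) /=.
rewrite (deriveE v (f1 q Wq)) -(derive_sqrt (f0 q Wq)) (@deriveE _ _ _ Num.sqrt _ (1 : R) ds).
move: ('d f q v) => x; rewrite -[X in _ = 'd _ _ X]mulr1.
by rewrite -[x * 1]/(x *: (1 : R)) linearZ.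
Qed.

Lemma smooth_ext f g :
  (forall q, W q -> f q = g q) -> smooth_on W f -> smooth_on W g.
Proof. by move=> fg /smooth_uptoP fk; apply/smooth_uptoP => k; apply: diff_upto_ext fg (fk k). Qed.

Lemma smooth_cst (c : R) : smooth_on W (fun=> c).
Proof. by apply/smooth_uptoP => k; exact: diff_upto_cst. Qed.

Lemma smoothD f g :
  smooth_on W f -> smooth_on W g -> smooth_on W (fun q => f q + g q).
Proof. by move=> /smooth_uptoP fk /smooth_uptoP gk; apply/smooth_uptoP => k; exact: diff_uptoD. Qed.

Lemma smoothM f g :
  smooth_on W f -> smooth_on W g -> smooth_on W (fun q => f q * g q).
Proof. by move=> /smooth_uptoP fk /smooth_uptoP gk; apply/smooth_uptoP => k; exact: diff_uptoM. Qed.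

Lemma smoothN f : smooth_on W f -> smooth_on W (fun q => - f q).
Proof.
move=> fs; apply: smooth_ext (smoothM (smooth_cst (-1)) fs) => q _.
by rewrite mulN1r.
Qed.

Lemma smoothV f : (forall q, W q -> f q != 0) ->
  smooth_on W f -> smooth_on W (fun q => (f q)^-1).
Proof. by move=> f0 /smooth_uptoP fk; apply/smooth_uptoP => k; exact: diff_uptoV. Qed.

Lemma smooth_sqrt f : (forall q, W q -> 0 < f q) ->
  smooth_on W f -> smooth_on W (fun q => Num.sqrt (f q)).
Proof. by move=> f0 /smooth_uptoP fk; apply/smooth_uptoP => k; exact: diff_upto_sqrt. Qed.

End RealSmooth.

Section ComplexSmooth.
Context {R : realType} {n : nat}.
Variable W : set (Cpoint R n).
Hypothesis Wo : open W.
Implicit Types (f g : Cpoint R n -> R[i]) (p v : Cpoint R n) (j : 'I_n.+1).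

Lemma csmooth_ext f g :
  (forall q, W q -> f q = g q) -> csmooth_on W f -> csmooth_on W g.
Proof.
move=> fg [f1 f2]; split; [apply: smooth_ext f1|apply: smooth_ext f2] => //.
- by move=> q Wq; rewrite fg.
- by move=> q Wq; rewrite fg.
Qed.

Lemma csmooth_cst (c : R[i]) : csmooth_on W (fun=> c).
Proof. by split; exact: smooth_cst. Qed.

Lemma csmooth_real (g : Cpoint R n -> R) :
  smooth_on W g -> csmooth_on W (fun q => (g q)%:C).
Proof. by move=> gs; split => //; exact: smooth_cst. Qed.

Lemma csmoothD f g :
  csmooth_on W f -> csmooth_on W g -> csmooth_on W (fun q => f q + g q).
Proof.
move=> [f1 f2] [g1 g2]; split.
- by apply: smooth_ext (smoothD Wo f1 g1) => // q _; rewrite Re_add.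
- by apply: smooth_ext (smoothD Wo f2 g2) => // q _; rewrite Im_add.
Qed.

Lemma csmoothM f g :
  csmooth_on W f -> csmooth_on W g -> csmooth_on W (fun q => f q * g q).
Proof.
move=> [f1 f2] [g1 g2]; split.
- apply: smooth_ext (smoothD Wo (smoothM Wo f1 g1) (smoothN Wo (smoothM Wo f2 g2))) => //.
  by move=> q _; rewrite Re_mul.
- apply: smooth_ext (smoothD Wo (smoothM Wo f1 g2) (smoothM Wo f2 g1)) => //.
  by move=> q _; rewrite Im_mul.
Qed.

Lemma csmoothN f : csmooth_on W f -> csmooth_on W (fun q => - f q).
Proof.
move=> fs; apply: csmooth_ext (csmoothM (csmooth_cst (-1)) fs) => q _.
by rewrite mulN1r.
Qed.

Lemma csmoothB f g :
  csmooth_on W f -> csmooth_on W g -> csmooth_on W (fun q => f q - g q).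
Proof. by move=> fs gs; apply: csmoothD => //; exact: csmoothN. Qed.

Lemma csmooth_sum (I : Type) (r : seq I) (F : I -> Cpoint R n -> R[i]) :
  (forall i, csmooth_on W (F i)) -> csmooth_on W (fun q => \sum_(i <- r) F i q).
Proof.
move=> Fs; elim: r => [|i r IH].
  by apply: csmooth_ext (csmooth_cst 0) => q _; rewrite big_nil.
by apply: csmooth_ext (csmoothD (Fs i) IH) => q _; rewrite big_cons.
Qed.

Lemma csmooth_conj f : csmooth_on W f -> csmooth_on W (fun q => (f q)^*%C).
Proof.
move=> [f1 f2]; split.
- by apply: smooth_ext f1 => // q _; case: (f q).
- by apply: smooth_ext (smoothN Wo f2) => // q _; case: (f q).
Qed.

Lemma csmoothV f : (forall q, W q -> f q != 0) ->
  csmooth_on W f -> csmooth_on W (fun q => (f q)^-1).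
Proof.
move=> f0 fs; have [f1 f2] := fs.
have s2 := smoothD Wo (smoothM Wo f1 f1) (smoothM Wo f2 f2).
have n0 q : W q -> complex.Re (f q) * complex.Re (f q)
                 + complex.Im (f q) * complex.Im (f q) != 0.
  move=> Wq; apply: contra (f0 q Wq) => /eqP.
  case: (f q) => x y /= /eqP; rewrite paddr_eq0 -?expr2 ?sqr_ge0// !sqrf_eq0.
  by move=> /andP[/eqP-> /eqP->].
apply: csmooth_ext (csmoothM (csmooth_conj fs) (csmooth_real (smoothV Wo n0 s2))).
move=> q Wq; rewrite invc_norm mulrC; congr (_ * _).
by rewrite -add_Re2_Im2 !expr2 fmorphV.
Qed.

Lemma csmooth_cderive f v : csmooth_on W f -> csmooth_on W (cderive v f).
Proof. by move=> [f1 f2]; split; exact: smooth_derive. Qed.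

Lemma csmooth_dz j f : csmooth_on W f -> csmooth_on W (dz j f).
Proof.
move=> fs; apply: csmoothM; first exact: csmooth_cst.
apply: csmoothB; first exact: csmooth_cderive.
by apply: csmoothM; [exact: csmooth_cst|exact: csmooth_cderive].
Qed.

Lemma csmooth_dzbar j f : csmooth_on W f -> csmooth_on W (dzbar j f).
Proof.
move=> fs; apply: csmoothM; first exact: csmooth_cst.
apply: csmoothD; first exact: csmooth_cderive.
by apply: csmoothM; [exact: csmooth_cst|exact: csmooth_cderive].
Qed.

End ComplexSmooth.

(** * Complex vectors as derivations *)

Section FirstOrder.
Context {R : realType} {n : nat}.
Implicit Types (f g : Cpoint R n -> R[i]) (p v : Cpoint R n) (j : 'I_n.+1).
Implicit Types (X Y : Cvec R n).

Definition cdiff f p :=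
  differentiable (fun q => complex.Re (f q)) p /\
  differentiable (fun q => complex.Im (f q)) p.

Lemma csmooth_cdiff W f p : csmooth_on W f -> W p -> cdiff f p.
Proof. by move=> [f1 f2] Wp; split; exact: smooth_differentiable Wp. Qed.

Lemma cderive_cst v c p : cderive v (fun=> c) p = 0.
Proof. by rewrite /cderive !(derive_cst _). Qed.

Lemma cderiveD v f g p : cdiff f p -> cdiff g p ->
  cderive v (fun q => f q + g q) p = cderive v f p + cderive v g p.
Proof.
move=> [f1 f2] [g1 g2]; rewrite /cderive.
rewrite (_ : (fun q => complex.Re (f q + g q)) =
  (fun q => complex.Re (f q)) \+ (fun q => complex.Re (g q))); last first.
  by apply/funext => q; rewrite Re_add.
rewrite (_ : (fun q => complex.Im (f q + g q)) =
  (fun q => complex.Im (f q)) \+ (fun q => complex.Im (g q))); last first.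
  by apply/funext => q; rewrite Im_add.
by rewrite !deriveD; do ?exact: diff_derivable.
Qed.

Lemma cdiffD f g p : cdiff f p -> cdiff g p -> cdiff (fun q => f q + g q) p.
Proof.
move=> [f1 f2] [g1 g2]; split.
- rewrite (_ : (fun q => complex.Re (f q + g q)) =
    (fun q => complex.Re (f q)) \+ (fun q => complex.Re (g q))).
    exact: differentiableD.
  by apply/funext => q; rewrite Re_add.
- rewrite (_ : (fun q => complex.Im (f q + g q)) =
    (fun q => complex.Im (f q)) \+ (fun q => complex.Im (g q))).
    exact: differentiableD.
  by apply/funext => q; rewrite Im_add.
Qed.

Lemma cderiveM v f g p : cdiff f p -> cdiff g p ->
  cderive v (fun q => f q * g q) p = cderive v f p * g p + f p * cderive v g p.
Proof.
move=> [f1 f2] [g1 g2]; rewrite /cderive.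
rewrite (_ : (fun q => complex.Re (f q * g q)) =
  (fun q => complex.Re (f q)) \* (fun q => complex.Re (g q)) \-
  (fun q => complex.Im (f q)) \* (fun q => complex.Im (g q))); last first.
  by apply/funext => q; rewrite Re_mul.
rewrite (_ : (fun q => complex.Im (f q * g q)) =
  (fun q => complex.Re (f q)) \* (fun q => complex.Im (g q)) \+
  (fun q => complex.Im (f q)) \* (fun q => complex.Re (g q))); last first.
  by apply/funext => q; rewrite Im_mul.
rewrite deriveB ?deriveD ?deriveM;
  do ?[exact: diff_derivable | by apply: derivableM; exact: diff_derivable].
case: (f p) (g p) => a b [c d] /=; rewrite /GRing.scale /=.
move: ('D_v _ _) ('D_v _ _) ('D_v _ _) ('D_v _ _) => a' b' c' d'.
by apply/eqP; rewrite eq_complex /=; apply/andP; split; apply/eqP; ring.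
Qed.

Lemma cdiffM f g p : cdiff f p -> cdiff g p -> cdiff (fun q => f q * g q) p.
Proof.
move=> [f1 f2] [g1 g2]; split.
- rewrite (_ : (fun q => complex.Re (f q * g q)) =
    (fun q => complex.Re (f q)) \* (fun q => complex.Re (g q)) \-
    (fun q => complex.Im (f q)) \* (fun q => complex.Im (g q))).
    by apply: differentiableB; exact: differentiableM.
  by apply/funext => q; rewrite Re_mul.
- rewrite (_ : (fun q => complex.Im (f q * g q)) =
    (fun q => complex.Re (f q)) \* (fun q => complex.Im (g q)) \+
    (fun q => complex.Im (f q)) \* (fun q => complex.Re (g q))).
    by apply: differentiableD; exact: differentiableM.
  by apply/funext => q; rewrite Im_mul.
Qed.

Lemma cdiff_cst c p : cdiff (fun=> c) p.
Proof. by split; exact: differentiable_cst. Qed.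

Lemma cdiff_real (g : Cpoint R n -> R) p :
  differentiable g p -> cdiff (fun q => (g q)%:C) p.
Proof. by move=> dg; split => //; exact: differentiable_cst. Qed.

Lemma cdiff_sum (I : Type) (r : seq I) (F : I -> Cpoint R n -> R[i]) p :
  (forall i, cdiff (F i) p) -> cdiff (fun q => \sum_(i <- r) F i q) p.
Proof.
move=> Fs; elim: r => [|i r IH].
  by rewrite (_ : (fun q => _) = (fun=> 0)) ?cdiff_cst//; apply/funext => q; rewrite big_nil.
rewrite (_ : (fun q => _) = (fun q => F i q + \sum_(i <- r) F i q)); first exact: cdiffD.
by apply/funext => q; rewrite big_cons.
Qed.

Lemma cdiff_conj f p : cdiff f p -> cdiff (fun q => (f q)^*%C) p.
Proof.
move=> [f1 f2]; split.
- by rewrite (_ : (fun q => complex.Re (f q)^*%C) = (fun q => complex.Re (f q)))//; apply/funext => q /=; case: (f q).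
- rewrite (_ : (fun q => complex.Im (f q)^*%C) = \- (fun q => complex.Im (f q))); first exact: differentiableN.
  by apply/funext => q /=; case: (f q).
Qed.

Lemma cderive_conj v f p : cdiff f p ->
  cderive v (fun q => (f q)^*%C) p = (cderive v f p)^*%C.
Proof.
move=> [f1 f2]; rewrite /cderive /=.
rewrite (_ : (fun q => complex.Re (f q)^*%C) = (fun q => complex.Re (f q))); last first.
  by apply/funext => q /=; case: (f q).
rewrite (_ : (fun q => complex.Im (f q)^*%C) = \- (fun q => complex.Im (f q))); last first.
  by apply/funext => q /=; case: (f q).
by rewrite deriveN//; exact: diff_derivable.
Qed.

Lemma conjc_half_addi (x y : R[i]) :
  (2^-1 * (x + 'i%C * y))^*%C = 2^-1 * (x^*%C - 'i%C * y^*%C).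
Proof.
rewrite halfC.
case: x y => [x1 y1] [x2 y2].
by apply/eqP; rewrite eq_complex /=; apply/andP; split; apply/eqP; ring.
Qed.

Lemma dz_conj j f p : cdiff f p ->
  dz j (fun q => (f q)^*%C) p = (dzbar j f p)^*%C.
Proof. by move=> df; rewrite /dz /dzbar !cderive_conj// conjc_half_addi. Qed.

Lemma dzbar_conj j f p : cdiff f p ->
  dzbar j (fun q => (f q)^*%C) p = (dz j f p)^*%C.
Proof.
move=> df; rewrite -[LHS]conjcK -dz_conj; last exact: cdiff_conj.
rewrite (_ : (fun q => ((f q)^*%C)^*%C) = f)//.
by apply/funext => q; rewrite conjcK.
Qed.

Lemma vact_cst X c p : vact X (fun=> c) p = 0.
Proof.
rewrite /vact big1// => j _; rewrite /dz /dzbar !cderive_cst.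
by rewrite !(mulr0, subr0, addr0).
Qed.

Lemma vactD X f g p : cdiff f p -> cdiff g p ->
  vact X (fun q => f q + g q) p = vact X f p + vact X g p.
Proof.
move=> df dg; rewrite /vact -big_split; apply: eq_bigr => j _ /=.
rewrite /dz /dzbar !cderiveD//.
move: (cderive (dx_dir j) f p) (cderive (dy_dir j) f p) => a b.
by move: (cderive (dx_dir j) g p) (cderive (dy_dir j) g p) => c d; ring.
Qed.

Lemma vactM X f g p : cdiff f p -> cdiff g p ->
  vact X (fun q => f q * g q) p = vact X f p * g p + f p * vact X g p.
Proof.
move=> df dg; rewrite /vact mulr_suml mulr_sumr -big_split; apply: eq_bigr => j _ /=.
rewrite /dz /dzbar !cderiveM//.
move: (cderive (dx_dir j) f p) (cderive (dy_dir j) f p) => a b.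
move: (cderive (dx_dir j) g p) (cderive (dy_dir j) g p) => c d.
by move: (f p) (g p) => u v; ring.
Qed.

Lemma vact_sum X (I : Type) (r : seq I) (F : I -> Cpoint R n -> R[i]) p :
  (forall i, cdiff (F i) p) ->
  vact X (fun q => \sum_(i <- r) F i q) p = \sum_(i <- r) vact X (F i) p.
Proof.
move=> Fs; elim: r => [|i r IH].
  rewrite big_nil (_ : (fun q => _) = (fun=> 0)) ?vact_cst//.
  by apply/funext => q; rewrite big_nil.
rewrite big_cons -IH -vactD//; last exact: cdiff_sum.
rewrite (_ : (fun q => _) = (fun q => F i q + \sum_(i <- r) F i q))//.
by apply/funext => q; rewrite big_cons.
Qed.

Lemma vact_cstM X c f p : cdiff f p -> vact X (fun q => c * f q) p = c * vact X f p.
Proof. by move=> df; rewrite vactM// ?vact_cst ?mul0r ?add0r//; exact: cdiff_cst. Qed.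

Lemma vact_conj X f p : cdiff f p ->
  vact (conjv X) (fun q => (f q)^*%C) p = (vact X f p)^*%C.
Proof.
move=> df; rewrite /vact rmorph_sum; apply: eq_bigr => j _ /=.
by rewrite !mxE dz_conj// dzbar_conj// -!rmorphM -rmorphD addrC.
Qed.

Lemma vactDl X Y f p : vact (X + Y) f p = vact X f p + vact Y f p.
Proof.
rewrite /vact -big_split; apply: eq_bigr => j _ /=.
by rewrite !mxE; move: (dz j f p) (dzbar j f p) => a b; ring.
Qed.

Lemma vactZl c X f p : vact (c *: X) f p = c * vact X f p.
Proof.
rewrite /vact mulr_sumr; apply: eq_bigr => j _ /=.
by rewrite !mxE; move: (dz j f p) (dzbar j f p) => a b; ring.
Qed.

Lemma cderive_ext v f g p : {near p, f =1 g} -> cderive v f p = cderive v g p.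
Proof.
move=> fg; rewrite /cderive; congr (_ +i* _); apply: near_eq_derive;
  by apply: filterS fg => q ->.
Qed.

Lemma vact_ext X f g p : {near p, f =1 g} -> vact X f p = vact X g p.
Proof.
move=> fg; rewrite /vact; apply: eq_bigr => j _.
by rewrite /dz /dzbar !(cderive_ext _ fg).
Qed.

(** The real vectors by which [X] acts on real functions, see [vact_real]; the
    factor 1/2 is that of [d/dz = (d/dx - i d/dy) / 2]. *)
Definition realv X : Cpoint R n :=
  (map_mx (fun c : R[i] => complex.Re (2^-1 * c)) (X.1 + X.2),
   map_mx (fun c : R[i] => complex.Re (2^-1 * c)) ('i%C *: (X.2 - X.1))).
Definition imagv X : Cpoint R n :=
  (map_mx (fun c : R[i] => complex.Im (2^-1 * c)) (X.1 + X.2),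
   map_mx (fun c : R[i] => complex.Im (2^-1 * c)) ('i%C *: (X.2 - X.1))).

Lemma Cpoint_sum v :
  v = \sum_j (v.1 0 j *: dx_dir j + v.2 0 j *: dy_dir j).
Proof.
case: v => x y /=; rewrite big_split /=.
have fstE (F : 'I_n.+1 -> Cpoint R n) : (\sum_j F j).1 = \sum_j (F j).1.
  by apply: (big_morph fst).
have sndE (F : 'I_n.+1 -> Cpoint R n) : (\sum_j F j).2 = \sum_j (F j).2.
  by apply: (big_morph snd).
rewrite [LHS]surjective_pairing [RHS]surjective_pairing /=.
rewrite !fstE !sndE /=.
rewrite [X in _ = (_ + X, _)]big1 ?addr0; last by move=> j _; rewrite scaler0.
rewrite [X in _ = (_, X + _)]big1 ?add0r; last by move=> j _; rewrite scaler0.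
by rewrite -!row_sum_delta.
Qed.

Lemma diff_coord (g : Cpoint R n -> R) p v : differentiable g p ->
  'd g p v = \sum_j (v.1 0 j * 'D_(dx_dir j) g p + v.2 0 j * 'D_(dy_dir j) g p).
Proof.
move=> dg; rewrite [in LHS](Cpoint_sum v) linear_sum; apply: eq_bigr => j _.
by rewrite linearD !linearZ /= !deriveE.
Qed.

Lemma vact_real X (g : Cpoint R n -> R) p : differentiable g p ->
  vact X (fun q => (g q)%:C) p = ('d g p (realv X)) +i* ('d g p (imagv X)).
Proof.
move=> dg; rewrite !diff_coord//.
have sumE (F G : 'I_n.+1 -> R) :
    (\sum_j F j) +i* (\sum_j G j) = \sum_j (F j +i* G j)%C.
  by elim/big_rec3: _ => // j a b c _ <-.
rewrite sumE /vact; apply: eq_bigr => j _.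
rewrite /dz /dzbar /cderive /=.
rewrite (_ : (fun q => g q) = g)// !(derive_cst _) !mxE.
move: ('D_(dx_dir j) g p) ('D_(dy_dir j) g p) => a b.
rewrite halfC.
case: (X.1 0 j) (X.2 0 j) => [x1 y1] [x2 y2].
by apply/eqP; rewrite eq_complex /=; apply/andP; split; apply/eqP; ring.
Qed.

Lemma vact_ReIm X f p : cdiff f p ->
  vact X f p = vact X (fun q => (complex.Re (f q))%:C) p
             + 'i%C * vact X (fun q => (complex.Im (f q))%:C) p.
Proof.
move=> [f1 f2].
have d1 := cdiff_real f1; have d2 := cdiff_real f2.
rewrite -vact_cstM// -vactD//; last by apply: cdiffM => //; exact: cdiff_cst.
rewrite [in LHS](_ : f = (fun q => (complex.Re (f q))%:C
                              + 'i%C * (complex.Im (f q))%:C))//.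
by apply/funext => q; rewrite -complexE.
Qed.

(** [X] is a complex combination of two real vectors in the kernel of [d rho], and
    [f] of its real and imaginary parts. *)
Lemma vact_tangent X (rho : Cpoint R n -> R) f p w :
  cdiff f p -> (\forall q \near p, differentiable rho q) -> rho p = 0 ->
  'd rho p w != 0 -> vact X (fun q => (rho q)%:C) p = 0 ->
  (\forall q \near p, rho q = 0 -> f q = 0) ->
  vact X f p = 0.
Proof.
move=> df dr rp rw Xr fz.
have drp : differentiable rho p by exact: nbhs_singleton dr.
move: Xr; rewrite vact_real// => /eqP; rewrite eq_complex /= => /andP[/eqP r1 /eqP r2].
have [f1 f2] := df; rewrite vact_ReIm// !vact_real//.
have z1 : \forall q \near p, rho q = 0 -> complex.Re (f q) = 0.
  by apply: filterS fz => q fq rq; rewrite fq.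
have z2 : \forall q \near p, rho q = 0 -> complex.Im (f q) = 0.
  by apply: filterS fz => q fq rq; rewrite fq.
rewrite (tangent_derive_eq0 f1 dr rp z1 rw r1) (tangent_derive_eq0 f1 dr rp z1 rw r2).
rewrite (tangent_derive_eq0 f2 dr rp z2 rw r1) (tangent_derive_eq0 f2 dr rp z2 rw r2).
by rewrite mulr0 addr0.
Qed.

End FirstOrder.

(** * Hermitian linear algebra *)

Section Hermitian.
Context {R : realType} {n : nat}.
Local Notation C := R[i].
Local Notation row := 'rV[C]_n.+1.
Implicit Types (x y z l : row).

Definition conjr x : row := map_mx conjc x.
Definition pairing l x : C := \sum_j l 0 j * x 0 j.
Definition bil (a : 'M[C]_n.+1) x y : C := \sum_j \sum_k a j k * x 0 j * y 0 k.

Lemma conjrK x : conjr (conjr x) = x.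
Proof. by apply/rowP => j; rewrite !mxE conjcK. Qed.
Lemma conjrD x y : conjr (x + y) = conjr x + conjr y.
Proof. by apply/rowP => j; rewrite !mxE rmorphD. Qed.
Lemma conjrZ c x : conjr (c *: x) = c^*%C *: conjr x.
Proof. by apply/rowP => j; rewrite !mxE rmorphM. Qed.
Lemma conjr0 : conjr 0 = 0.
Proof. by apply/rowP => j; rewrite !mxE conjc0. Qed.
Lemma conjrN x : conjr (- x) = - conjr x.
Proof. by apply/rowP => j; rewrite !mxE rmorphN. Qed.
Lemma conjr_sum (I : Type) (r : seq I) (F : I -> row) :
  conjr (\sum_(i <- r) F i) = \sum_(i <- r) conjr (F i).
Proof. exact: (big_morph _ conjrD conjr0). Qed.

Lemma pairC x y : pairing x y = pairing y x.
Proof. by apply: eq_bigr => j _; rewrite mulrC. Qed.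
Lemma pairDr l x y : pairing l (x + y) = pairing l x + pairing l y.
Proof. by rewrite /pairing -big_split; apply: eq_bigr => j _; rewrite mxE mulrDr. Qed.
Lemma pairZr l c x : pairing l (c *: x) = c * pairing l x.
Proof. by rewrite /pairing mulr_sumr; apply: eq_bigr => j _; rewrite mxE mulrCA. Qed.
Lemma pair0r l : pairing l 0 = 0.
Proof. by rewrite /pairing big1// => j _; rewrite mxE mulr0. Qed.
Lemma pairNr l x : pairing l (- x) = - pairing l x.
Proof. by rewrite -scaleN1r pairZr mulN1r. Qed.
Lemma pair_sumr l (I : Type) (r : seq I) (F : I -> row) :
  pairing l (\sum_(i <- r) F i) = \sum_(i <- r) pairing l (F i).
Proof. exact: (big_morph _ (pairDr l) (pair0r l)). Qed.
Lemma pair_conj l x : pairing (conjr l) (conjr x) = (pairing l x)^*%C.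
Proof. by rewrite /pairing rmorph_sum; apply: eq_bigr => j _; rewrite !mxE rmorphM. Qed.

Variable a : 'M[C]_n.+1.

Lemma bilDl x y z : bil a (x + y) z = bil a x z + bil a y z.
Proof.
rewrite /bil -big_split; apply: eq_bigr => j _; rewrite -big_split; apply: eq_bigr => k _.
by rewrite mxE mulrDr mulrDl.
Qed.
Lemma bilDr x y z : bil a x (y + z) = bil a x y + bil a x z.
Proof.
rewrite /bil -big_split; apply: eq_bigr => j _; rewrite -big_split; apply: eq_bigr => k _.
by rewrite mxE mulrDr.
Qed.
Lemma bilZl c x y : bil a (c *: x) y = c * bil a x y.
Proof.
rewrite /bil mulr_sumr; apply: eq_bigr => j _; rewrite mulr_sumr; apply: eq_bigr => k _.
by rewrite mxE mulrCA !mulrA.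
Qed.
Lemma bilZr c x y : bil a x (c *: y) = c * bil a x y.
Proof.
rewrite /bil mulr_sumr; apply: eq_bigr => j _; rewrite mulr_sumr; apply: eq_bigr => k _.
by rewrite mxE mulrCA !mulrA.
Qed.
Lemma bil0l x : bil a 0 x = 0.
Proof. by rewrite -(scale0r (0 : row)) bilZl mul0r. Qed.
Lemma bil0r x : bil a x 0 = 0.
Proof. by rewrite -(scale0r (0 : row)) bilZr mul0r. Qed.
Lemma bilNl x y : bil a (- x) y = - bil a x y.
Proof. by rewrite -scaleN1r bilZl mulN1r. Qed.
Lemma bilNr x y : bil a x (- y) = - bil a x y.
Proof. by rewrite -scaleN1r bilZr mulN1r. Qed.
Lemma bil_suml (I : Type) (r : seq I) (F : I -> row) x :
  bil a (\sum_(i <- r) F i) x = \sum_(i <- r) bil a (F i) x.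
Proof. by apply: (big_morph (bil a ^~ x)) => [u v|]; rewrite ?bilDl ?bil0l. Qed.
Lemma bil_sumr (I : Type) (r : seq I) (F : I -> row) x :
  bil a x (\sum_(i <- r) F i) = \sum_(i <- r) bil a x (F i).
Proof. by apply: (big_morph (bil a x)) => [u v|]; rewrite ?bilDr ?bil0r. Qed.

Hypothesis a_herm : forall j k, a j k = (a k j)^*%C.

Lemma bil_conj x y : (bil a x y)^*%C = bil a (conjr y) (conjr x).
Proof.
rewrite /bil rmorph_sum exchange_big; apply: eq_bigr => j _.
rewrite rmorph_sum; apply: eq_bigr => k _.
by rewrite !mxE !rmorphM /= -a_herm mulrAC.
Qed.

Hypothesis a_pos : forall v : row, v != 0 -> 0 < bil a v (conjr v).

Lemma bil_eq0 v : bil a v (conjr v) = 0 -> v = 0.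
Proof. by move=> v0; apply/eqP; apply: contraT => /a_pos; rewrite v0 ltxx. Qed.

Lemma pairM_bil x y : pairing (x *m a) y = bil a x y.
Proof.
rewrite /pairing /bil exchange_big; apply: eq_bigr => k _.
rewrite mxE mulr_suml; apply: eq_bigr => j _.
by rewrite [x 0 j * _]mulrC.
Qed.

Lemma pairM_tr (y x : row) : pairing (y *m a^T) x = bil a x y.
Proof.
rewrite /pairing /bil; apply: eq_bigr => j _; rewrite mxE mulr_suml.
by apply: eq_bigr => k _; rewrite mxE; ring.
Qed.

Lemma a_unit : a \in unitmx.
Proof.
rewrite -row_free_unit -kermx_eq0; apply/rowV0P => v /sub_kermxP va0.
by apply: bil_eq0; rewrite -pairM_bil va0 pairC pair0r.
Qed.

(** [grad l] is the metric gradient of the covector [l], [xi l] its multiple on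
    which [l] takes the value 1. *)
Definition grad l : row := conjr l *m invmx a.
Definition grad2 l : C := pairing l (grad l).
Definition xi l : row := (grad2 l)^-1 *: grad l.

Lemma bil_grad l z : bil a (grad l) z = pairing (conjr l) z.
Proof. by rewrite -pairM_bil /grad mulmxKV// a_unit. Qed.

Lemma grad2_bil l : bil a (grad l) (conjr (grad l)) = (grad2 l)^*%C.
Proof. by rewrite bil_grad pair_conj. Qed.

Lemma grad2_gt0 l : l != 0 -> 0 < grad2 l.
Proof.
move=> l0; have : grad l != 0.
  apply: contra l0 => /eqP g0; apply/eqP; rewrite -(conjrK l).
  by rewrite -(mulmxKV a_unit (conjr l)) -/(grad l) g0 mul0mx conjr0.
move/a_pos; rewrite grad2_bil => H.
have : 0 < (grad2 l)^*%C by [].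
by rewrite lt_def conj_ge0 conjc_eq0 -lt_def.
Qed.

Lemma grad2_real l : (grad2 l)^*%C = grad2 l.
Proof. by rewrite -grad2_bil -[LHS]conjcK bil_conj conjrK grad2_bil conjcK. Qed.

Lemma bil_xi l z : bil a (xi l) z = (grad2 l)^-1 * pairing (conjr l) z.
Proof. by rewrite bilZl bil_grad. Qed.

Lemma pair_xi l : l != 0 -> pairing l (xi l) = 1.
Proof. by move=> l0; rewrite pairZr mulVf// gt_eqF// grad2_gt0. Qed.

(** A dimension count: the span of [Z] lies in [ker l], and both have dimension
    [n]. *)
Lemma span_hyperplane l (Z : 'I_n -> row) x : l != 0 ->
  row_free (\matrix_al Z al) -> (forall al, pairing l (Z al) = 0) -> pairing l x = 0 ->
  exists c : 'I_n -> C, x = \sum_al c al *: Z al.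
Proof.
move=> l0 Zf lZ lx.
have pairE y : (y *m l^T) = (pairing l y)%:M.
  apply/matrixP => i j; rewrite !ord1 !mxE eqxx mulr1n.
  by apply: eq_bigr => k _; rewrite mxE mulrC.
have sZ : (\matrix_al Z al <= kermx l^T)%MS.
  by apply/row_subP => al; rewrite rowK; apply/sub_kermxP; rewrite pairE lZ raddf0.
have : (kermx l^T <= \matrix_al Z al)%MS.
  rewrite -(mxrank_leqif_sup sZ).2 mxrank_ker mxrank_tr (eqP Zf).
  by rewrite rank_rV l0 subn1.
move=> kZ; have : (x <= kermx l^T)%MS by apply/sub_kermxP; rewrite pairE lx raddf0.
move=> /submx_trans /(_ kZ) /submxP[D ->].
exists (fun al => D 0 al); rewrite mulmx_sum_row; apply: eq_bigr => al _.
by rewrite rowK.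
Qed.

(** The difference of the two sides lies in [ker l], which [Z] spans, and is
    orthogonal to [Z], hence to itself. *)
Lemma orthogonal_xi l (Z : 'I_n -> row) x : l != 0 ->
  row_free (\matrix_al Z al) -> (forall al, pairing l (Z al) = 0) ->
  (forall al, bil a x (conjr (Z al)) = 0) -> x = pairing l x *: xi l.
Proof.
move=> l0 Zf lZ xZ; apply/eqP; rewrite -subr_eq0; apply/eqP; set y := _ - _.
have ly : pairing l y = 0 by rewrite pairDr pairNr pairZr pair_xi// mulr1 subrr.
have [c yE] := span_hyperplane l0 Zf lZ ly.
apply: bil_eq0; rewrite [X in conjr X]yE conjr_sum bil_sumr big1// => al _.
rewrite conjrZ bilZr bilDl bilNl bilZl bil_xi pair_conj lZ xZ conjc0.
by rewrite !mulr0 subrr mulr0.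
Qed.

Lemma orthonormal_row_free m (E : 'I_m -> row) :
  (forall al be, bil a (E al) (conjr (E be)) = (al == be)%:R) ->
  row_free (\matrix_al E al).
Proof.
move=> EE; apply/row_freeP; exists (a *m (\matrix_al conjr (E al))^T).
apply/matrixP => al be; rewrite mulmxA mxE [RHS]mxE -EE -pairM_bil.
apply: eq_bigr => k _; rewrite !mxE; congr (_ * _).
by apply: eq_bigr => j _; rewrite !mxE.
Qed.

Lemma orthonormal_expansion l (E : 'I_n -> row) x : l != 0 ->
  (forall al be, bil a (E al) (conjr (E be)) = (al == be)%:R) ->
  (forall al, pairing l (E al) = 0) ->
  x = \sum_al bil a x (conjr (E al)) *: E al + pairing l x *: xi l.
Proof.
move=> l0 EE lE; apply/eqP; rewrite addrC -subr_eq; apply/eqP.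
set s := \sum_al _; have ls : pairing l s = 0.
  by rewrite pair_sumr big1// => al _; rewrite pairZr lE mulr0.
rewrite (orthogonal_xi l0 (orthonormal_row_free EE) lE (x := x - s)).
  by rewrite pairDr pairNr ls subr0.
move=> al; rewrite bilDl bilNl bil_suml (bigD1 al)//= big1 => [|be /negbTE ne].
  by rewrite bilZl EE eqxx mulr1 addr0 subrr.
by rewrite bilZl EE ne mulr0.
Qed.

(** The step of the Gram-Schmidt process: orthogonality to [w] and to [m] vectors
    is a system of [m + 1 <= n] linear equations in [n + 1] unknowns, so it has a
    nonzero solution, which is then normalised. *)
Lemma orthonormal_exists (w : row) m : (m <= n)%N ->
  exists f : 'I_m -> row,
    (forall al be, bil a (f al) (conjr (f be)) = (al == be)%:R) /\
    (forall al, bil a (f al) (conjr w) = 0).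
Proof.
elim: m => [_|m IH mn]; first by exists (fun=> 0); split=> [[]|[]].
have [f [ff fw]] := IH (ltnW mn).
(* Row [ord_max] is the condition coming from [w]. *)
pose M : 'M[C]_(m.+1, n.+1) :=
  \matrix_i (oapp (fun al => conjr (f al)) (conjr w) (unlift ord_max i) *m a^T).
have : kermx M^T != 0.
  rewrite -mxrank_eq0 mxrank_ker mxrank_tr subn_eq0 -ltnNge.
  by rewrite (leq_ltn_trans (rank_leq_row M)).
move=> /rowV0Pn[v /sub_kermxP vM v0].
have vorth i : bil a v (oapp (fun al => conjr (f al)) (conjr w) (unlift ord_max i)) = 0.
  have /matrixP/(_ 0 i) := vM; rewrite !mxE => <-.
  rewrite /bil; apply: eq_bigr => j _; rewrite !mxE mulr_sumr.
  by apply: eq_bigr => k _; rewrite !mxE; ring.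
have vw : bil a v (conjr w) = 0 by have := vorth ord_max; rewrite unlift_none.
have vf al : bil a v (conjr (f al)) = 0.
  by have := vorth (lift ord_max al); rewrite liftK.
have b0 := a_pos v0; set b := bil a v (conjr v) in b0.
pose u := (sqrtC b)^-1 *: v.
have s0 : 0 < sqrtC b by rewrite sqrtC_gt0.
have sr : ((sqrtC b)^-1)^*%C = (sqrtC b)^-1.
  rewrite conjc_inv; congr (_^-1).
  have := ltW s0; rewrite lecE /= => /andP[/eqP + _].
  by case: (sqrtC b) => c d /= ->; rewrite oppr0.
have uu : bil a u (conjr u) = 1.
  rewrite bilZl conjrZ bilZr sr -/b mulrA -invfM -expr2 sqrtCK mulVf//.
  by rewrite gt_eqF.
have uf al : bil a u (conjr (f al)) = 0 by rewrite bilZl vf mulr0.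
have fu al : bil a (f al) (conjr u) = 0.
  by rewrite -[LHS]conjcK bil_conj conjrK uf conjc0.
exists (fun i => oapp f u (unlift ord_max i)); split.
  move=> al be; case: unliftP => [al' ->|->]; case: unliftP => [be' ->|->] /=.
  - by rewrite ff (inj_eq lift_inj).
  - by rewrite fu eq_sym (negbTE (neq_lift _ _)).
  - by rewrite uf (negbTE (neq_lift _ _)).
  - by rewrite uu eqxx.
move=> al; case: unliftP => [al' _|_] /=; first exact: fw.
by rewrite bilZl vw mulr0.
Qed.

(** If [v] and [w] are unit vectors with [1 + (w, v) <> 0], this map sends the
    orthogonal complement of [w] isometrically onto that of [v], and it depends
    smoothly on [v]. *)
Definition rotate (w v x : row) : row :=
  x - (bil a x (conjr v) / (1 + bil a w (conjr v))) *: (v + w).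

Section Rotate.
Variables v w : row.
Hypotheses (vv : bil a v (conjr v) = 1) (ww : bil a w (conjr w) = 1).
Hypothesis t0 : 1 + bil a w (conjr v) != 0.

Lemma rotate_orth x : bil a (rotate w v x) (conjr v) = 0.
Proof. by rewrite /rotate bilDl bilNl bilZl bilDl vv divfK// subrr. Qed.

Lemma rotate_isometry x y : bil a x (conjr w) = 0 -> bil a y (conjr w) = 0 ->
  bil a (rotate w v x) (conjr (rotate w v y)) = bil a x (conjr y).
Proof.
move=> xw yw; have cj u z : bil a z (conjr u) = (bil a u (conjr z))^*%C.
  by rewrite bil_conj// conjrK.
have rw : bil a (rotate w v x) (conjr w) =
    - (bil a x (conjr v) / (1 + bil a w (conjr v)) * (1 + bil a w (conjr v))^*%C).
  rewrite /rotate bilDl bilNl bilZl bilDl ww xw add0r (cj w v).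
  by rewrite conjc_add conjc1 (addrC (bil a w (conjr v))^*%C).
rewrite {2}/rotate conjrD conjrN conjrZ conjrD bilDr bilNr bilZr bilDr.
rewrite rotate_orth add0r rw.
rewrite /rotate bilDl bilNl bilZl bilDl (cj y w) yw conjc0 addr0 (cj y v).
rewrite conjc_mul conjc_inv.
have tc0 : (1 + bil a w (conjr v))^*%C != 0 by rewrite conjc_eq0.
move: (1 + _) t0 tc0 (bil a x (conjr v)) => t tn0 tc x'; move: t^*%C tc => t' t'n0.
move: (bil a y (conjr v))^*%C (bil a x (conjr y)) => y' z; field.
by rewrite ?tn0 ?t'n0.
Qed.

End Rotate.

End Hermitian.

(** * Fields with values in row vectors *)

Section RowFields.
Context {R : realType} {n : nat}.
Local Notation row := 'rV[R[i]]_n.+1.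
Implicit Types (y z : Cpoint R n -> row) (c : Cpoint R n -> R[i]).
Implicit Types (p : Cpoint R n) (X Y : Cvec R n).

Definition rdiff y p := forall j, cdiff (fun q => y q 0 j) p.

Definition rowD X y p : row := \row_j vact X (fun q => y q 0 j) p.

Lemma flatDE X (Y : Cpoint R n -> Cvec R n) p :
  flatD X Y p = (rowD X (fun q => (Y q).1) p, rowD X (fun q => (Y q).2) p).
Proof. by []. Qed.

Lemma form_evalE (s X : Cvec R n) : form_eval s X = pairing s.1 X.1 + pairing s.2 X.2.
Proof. by rewrite /form_eval big_split. Qed.

Lemma rowDDl X Y y p : rowD (X + Y) y p = rowD X y p + rowD Y y p.
Proof. by apply/rowP => j; rewrite !mxE vactDl. Qed.
Lemma rowDZl (k : R[i]) X y p : rowD (k *: X) y p = k *: rowD X y p.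
Proof. by apply/rowP => j; rewrite !mxE vactZl. Qed.
Lemma rdiff_conj y p : rdiff y p -> rdiff (fun q => conjr (y q)) p.
Proof.
move=> dy j; rewrite (_ : (fun q => _) = (fun q => (y q 0 j)^*%C)); first exact: cdiff_conj.
by apply/funext => q; rewrite mxE.
Qed.

Lemma rdiffZ c y p : cdiff c p -> rdiff y p -> rdiff (fun q => c q *: y q) p.
Proof.
move=> dc dy j; rewrite (_ : (fun q => _) = (fun q => c q * y q 0 j)); first exact: cdiffM.
by apply/funext => q; rewrite mxE.
Qed.

Lemma rdiff_sum (I : Type) (r : seq I) (F : I -> Cpoint R n -> row) p :
  (forall i, rdiff (F i) p) -> rdiff (fun q => \sum_(i <- r) F i q) p.
Proof.
move=> dF j; rewrite (_ : (fun q => _) = (fun q => \sum_(i <- r) F i q 0 j)).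
  by apply: cdiff_sum => i; exact: dF.
by apply/funext => q; rewrite summxE.
Qed.

Lemma rowD_cst X (v : row) p : rowD X (fun=> v) p = 0.
Proof. by apply/rowP => j; rewrite [RHS]mxE [LHS]mxE vact_cst. Qed.

Lemma cdiff_pair y z p : rdiff y p -> rdiff z p ->
  cdiff (fun q => pairing (y q) (z q)) p.
Proof. by move=> dy dz; apply: cdiff_sum => j; exact: cdiffM. Qed.

Lemma cdiff_bil (a : 'M[R[i]]_n.+1) y z p : rdiff y p -> rdiff z p ->
  cdiff (fun q => bil a (y q) (z q)) p.
Proof.
move=> dy dz; apply: cdiff_sum => j; apply: cdiff_sum => k.
by apply: cdiffM => //; apply: cdiffM => //; exact: cdiff_cst.
Qed.

Lemma rowD_conj X y p : rdiff y p ->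
  rowD (conjv X) (fun q => conjr (y q)) p = conjr (rowD X y p).
Proof.
move=> dy; apply/rowP => j; rewrite !mxE -vact_conj//.
rewrite (_ : (fun q => conjr (y q) 0 j) = (fun q => (y q 0 j)^*%C))//.
by apply/funext => q; rewrite mxE.
Qed.

Lemma rowDZ X c y p : cdiff c p -> rdiff y p ->
  rowD X (fun q => c q *: y q) p = vact X c p *: y p + c p *: rowD X y p.
Proof.
move=> dc dy; apply/rowP => j; rewrite !mxE -vactM//.
rewrite (_ : (fun q => (c q *: y q) 0 j) = (fun q => c q * y q 0 j))//.
by apply/funext => q; rewrite mxE.
Qed.

Lemma rowD_sum X (I : Type) (r : seq I) (F : I -> Cpoint R n -> row) p :
  (forall i, rdiff (F i) p) ->
  rowD X (fun q => \sum_(i <- r) F i q) p = \sum_(i <- r) rowD X (F i) p.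
Proof.
move=> dF; apply/rowP => j; rewrite summxE mxE.
rewrite (_ : (fun q => _) = (fun q => \sum_(i <- r) F i q 0 j)).
  rewrite vact_sum; last by move=> i; exact: dF.
  by apply: eq_bigr => i _; rewrite mxE.
by apply/funext => q; rewrite summxE.
Qed.

Lemma vact_pair X y z p : rdiff y p -> rdiff z p ->
  vact X (fun q => pairing (y q) (z q)) p =
  pairing (rowD X y p) (z p) + pairing (y p) (rowD X z p).
Proof.
move=> dy dz; rewrite vact_sum; last by move=> j; exact: cdiffM.
by rewrite -big_split; apply: eq_bigr => j _; rewrite vactM// !mxE.
Qed.

Lemma vact_bil (a : 'M[R[i]]_n.+1) X y z p : rdiff y p -> rdiff z p ->
  vact X (fun q => bil a (y q) (z q)) p =
  bil a (rowD X y p) (z p) + bil a (y p) (rowD X z p).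
Proof.
move=> dy dz; have dayz j k : cdiff (fun q => a j k * y q 0 j * z q 0 k) p.
  by apply: cdiffM => //; apply: cdiffM => //; exact: cdiff_cst.
rewrite vact_sum; last by move=> j; exact: cdiff_sum.
rewrite -big_split; apply: eq_bigr => j _.
rewrite vact_sum// -big_split; apply: eq_bigr => k _ /=.
have da : cdiff (fun q => a j k * y q 0 j) p by apply: cdiffM => //; exact: cdiff_cst.
by rewrite vactM// vact_cstM// !mxE.
Qed.

Lemma vsmooth_rdiff1 W (Y : Cpoint R n -> Cvec R n) p : vsmooth_on W Y -> W p ->
  rdiff (fun q => (Y q).1) p.
Proof. by move=> Ys Wp j; have [Y1 _] := Ys j; exact: csmooth_cdiff Y1 Wp. Qed.

Lemma vsmooth_rdiff2 W (Y : Cpoint R n -> Cvec R n) p : vsmooth_on W Y -> W p ->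
  rdiff (fun q => (Y q).2) p.
Proof. by move=> Ys Wp j; have [_ Y2] := Ys j; exact: csmooth_cdiff Y2 Wp. Qed.

Lemma conjvE X : conjv X = (conjr X.2, conjr X.1). Proof. by []. Qed.

Lemma conjvK X : conjv (conjv X) = X.
Proof. by case: X => x y; rewrite !conjvE /= !conjrK. Qed.

Lemma conjv1 X : (conjv X).1 = conjr X.2. Proof. by []. Qed.
Lemma conjv2 X : (conjv X).2 = conjr X.1. Proof. by []. Qed.

Lemma conjvD (v w : Cvec R n) : conjv (v + w) = conjv v + conjv w.
Proof. by rewrite !conjvE /= !conjrD. Qed.

Lemma conjvZ (k : R[i]) (v : Cvec R n) : conjv (k *: v) = k^*%C *: conjv v.
Proof. by rewrite !conjvE /= !conjrZ. Qed.

Lemma conjvN (v : Cvec R n) : conjv (- v) = - conjv v.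
Proof. by rewrite !conjvE /= !conjrN. Qed.

Lemma conjv_sum (I : Type) (r : seq I) (F : I -> Cvec R n) :
  conjv (\sum_(i <- r) F i) = \sum_(i <- r) conjv (F i).
Proof.
apply: (big_morph _ conjvD); by rewrite conjvE /= !conjr0.
Qed.

Lemma fst_sum (I : Type) (r : seq I) (F : I -> Cvec R n) :
  (\sum_(i <- r) F i).1 = \sum_(i <- r) (F i).1.
Proof. exact: (big_morph fst (id1 := 0) (op1 := +%R)). Qed.

Lemma form_evalC (s X : Cvec R n) : form_eval s X = form_eval X s.
Proof. by rewrite !form_evalE pairC [X in _ + X]pairC. Qed.

Lemma form_evalD (s X Y : Cvec R n) : form_eval s (X + Y) = form_eval s X + form_eval s Y.
Proof. by rewrite !form_evalE !pairDr addrACA. Qed.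

Lemma form_evalZ (s : Cvec R n) (k : R[i]) X : form_eval s (k *: X) = k * form_eval s X.
Proof. by rewrite !form_evalE !pairZr mulrDr. Qed.

Lemma form_eval_conj (s X : Cvec R n) :
  form_eval (conjv s) (conjv X) = (form_eval s X)^*%C.
Proof. by rewrite !form_evalE !conjvE /= !pair_conj addrC rmorphD. Qed.

Lemma kahler_formE (a : 'M[R[i]]_n.+1) X Y :
  kahler_form a X Y = 'i%C * (bil a X.1 Y.2 - bil a Y.1 X.2).
Proof.
rewrite /kahler_form /bil; congr (_ * _); rewrite -sumrB; apply: eq_bigr => j _.
by rewrite -sumrB; apply: eq_bigr => k _; ring.
Qed.

Lemma metric_formE (a : 'M[R[i]]_n.+1) X Y : metric_form a X Y = bil a X.1 Y.2 + bil a Y.1 X.2.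
Proof.
rewrite /metric_form /bil -big_split; apply: eq_bigr => j _.
by rewrite -big_split; apply: eq_bigr => k _ /=; ring.
Qed.

End RowFields.

Section RowSmooth.
Context {R : realType} {n : nat}.
Local Notation row := 'rV[R[i]]_n.+1.
Variable W : set (Cpoint R n).
Hypothesis Wo : open W.
Implicit Types (y z : Cpoint R n -> row).

Definition rsmooth y := forall j, csmooth_on W (fun q => y q 0 j).

Lemma rsmooth_ext y z : (forall q, W q -> y q = z q) -> rsmooth y -> rsmooth z.
Proof. by move=> yz ys j; apply: csmooth_ext (ys j) => // q Wq; rewrite yz. Qed.

Lemma rsmooth_rdiff y q : rsmooth y -> W q -> rdiff y q.
Proof. by move=> ys Wq j; exact: csmooth_cdiff (ys j) Wq. Qed.

Lemma rsmooth_cst (v : row) : rsmooth (fun=> v).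
Proof. by move=> j; exact: csmooth_cst. Qed.

Lemma rsmoothD y z : rsmooth y -> rsmooth z -> rsmooth (fun q => y q + z q).
Proof.
move=> ys zs j; apply: csmooth_ext (csmoothD Wo (ys j) (zs j)) => // q _.
by rewrite mxE.
Qed.

Lemma rsmoothZ (c : Cpoint R n -> R[i]) y :
  csmooth_on W c -> rsmooth y -> rsmooth (fun q => c q *: y q).
Proof.
move=> cs ys j; apply: csmooth_ext (csmoothM Wo cs (ys j)) => // q _.
by rewrite mxE.
Qed.

Lemma rsmoothN y : rsmooth y -> rsmooth (fun q => - y q).
Proof.
move=> ys; apply: rsmooth_ext (rsmoothZ (csmooth_cst Wo (-1)) ys) => q _.
by rewrite scaleN1r.
Qed.

Lemma rsmooth_sum (I : Type) (r : seq I) (F : I -> Cpoint R n -> row) :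
  (forall i, rsmooth (F i)) -> rsmooth (fun q => \sum_(i <- r) F i q).
Proof.
move=> Fs j; apply: csmooth_ext (csmooth_sum Wo r (fun i => Fs i j)) => // q _.
by rewrite summxE.
Qed.

Lemma rsmooth_conj y : rsmooth y -> rsmooth (fun q => conjr (y q)).
Proof.
by move=> ys j; apply: csmooth_ext (csmooth_conj Wo (ys j)) => // q _; rewrite mxE.
Qed.

Lemma rsmooth_mul y (B : 'M[R[i]]_n.+1) : rsmooth y -> rsmooth (fun q => y q *m B).
Proof.
move=> ys j; apply: csmooth_ext (csmooth_sum Wo (index_enum _)
  (fun k => csmoothM Wo (ys k) (csmooth_cst Wo (B k j)))) => // q _.
by rewrite mxE.
Qed.

Lemma csmooth_pairing y z : rsmooth y -> rsmooth z ->
  csmooth_on W (fun q => pairing (y q) (z q)).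
Proof.
move=> ys zs; exact: csmooth_sum (fun k => csmoothM Wo (ys k) (zs k)).
Qed.

Lemma csmooth_bil (a : 'M[R[i]]_n.+1) y z : rsmooth y -> rsmooth z ->
  csmooth_on W (fun q => bil a (y q) (z q)).
Proof.
move=> ys zs; apply: csmooth_sum => // j; apply: csmooth_sum => // k.
apply: csmoothM => //; apply: csmoothM => //; exact: csmooth_cst.
Qed.

Lemma vsmooth_pair y z : rsmooth y -> rsmooth z -> vsmooth_on W (fun q => (y q, z q)).
Proof. by move=> ys zs j; split; [exact: ys|exact: zs]. Qed.

Lemma conjv_smooth (Y : Cpoint R n -> Cvec R n) : vsmooth_on W Y -> vsmooth_on W (fun q => conjv (Y q)).
Proof.
move=> Ys j; have [Y1 Y2] := Ys j.
by split; [apply: csmooth_ext (csmooth_conj Wo Y2)|apply: csmooth_ext (csmooth_conj Wo Y1)]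
  => // q _; rewrite mxE.
Qed.

End RowSmooth.

(** * The hypersurface *)

Section Geometry.
Context {R : realType} {n : nat}.
Local Notation C := R[i].
Local Notation row := 'rV[R[i]]_n.+1.
Variables (U : set (Cpoint R n)) (rho : Cpoint R n -> R) (a : 'M[R[i]]_n.+1).
Hypothesis U_open : open U.
Hypothesis rho_smooth : smooth_on U rho.
Hypothesis drho_neq0 : forall p, hypersurface U rho p -> exists v, 'd rho p v != 0.
Hypothesis a_herm : forall j k, a j k = (a k j)^*%C.
Hypothesis rho_a : complex_hessian_o U rho a.
Implicit Types (p q : Cpoint R n) (X Y : Cvec R n).

Local Notation M := (hypersurface U rho).

Lemma M_U p : M p -> U p. Proof. by case. Qed.
Lemma M_rho p : M p -> rho p = 0. Proof. by case. Qed.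

Lemma rhoC_smooth : csmooth_on U (fun q => (rho q)%:C).
Proof. exact: csmooth_real. Qed.

Lemma rho_csmooth j : csmooth_on U (rho_ rho j).
Proof. exact/csmooth_dz/rhoC_smooth. Qed.

Lemma rhobar_csmooth j : csmooth_on U (rhobar_ rho j).
Proof. exact/csmooth_dzbar/rhoC_smooth. Qed.

Lemma rho_cdiff j p : U p -> cdiff (rho_ rho j) p.
Proof. exact: csmooth_cdiff (rho_csmooth j). Qed.

Lemma rhobar_cdiff j p : U p -> cdiff (rhobar_ rho j) p.
Proof. exact: csmooth_cdiff (rhobar_csmooth j). Qed.

Lemma near_U p : U p -> \forall q \near p, U q.
Proof. by move=> Up; exact: open_nbhs_nbhs. Qed.

(** The (1,0) part of [d rho]. *)
Definition drow p : row := \row_j rho_ rho j p.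

Lemma rhobarE k p : U p -> rhobar_ rho k p = (rho_ rho k p)^*%C.
Proof.
move=> Up; rewrite /rhobar_ /rho_ -dzbar_conj; last exact: csmooth_cdiff rhoC_smooth Up.
rewrite (_ : (fun q => (rho q)%:C^*%C) = (fun q => (rho q)%:C))//.
by apply/funext => q; rewrite conjc_real.
Qed.

Lemma drow_rdiff p : U p -> rdiff drow p.
Proof.
move=> Up j; rewrite (_ : (fun q => _) = rho_ rho j); first exact: rho_cdiff.
by apply/funext => q; rewrite mxE.
Qed.

Lemma CTME p X : U p -> CTM rho p X <->
  pairing (drow p) X.1 + pairing (conjr (drow p)) X.2 = 0.
Proof.
move=> Up; rewrite /CTM /= big_split /=.
suff -> : \sum_j rho_ rho j p * X.1 0 j + \sum_j rhobar_ rho j p * X.2 0 j =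
  pairing (drow p) X.1 + pairing (conjr (drow p)) X.2 by [].
by congr (_ + _); apply: eq_bigr => j _; rewrite !mxE ?rhobarE.
Qed.

Lemma CTM_vact p X : CTM rho p X <-> vact X (fun q => (rho q)%:C) p = 0.
Proof.
rewrite /CTM /= /vact.
suff -> : \sum_j (rho_ rho j p * X.1 0 j + rhobar_ rho j p * X.2 0 j) =
  \sum_j (X.1 0 j * dz j (fun q => (rho q)%:C) p +
          X.2 0 j * dzbar j (fun q => (rho q)%:C) p) by [].
by apply: eq_bigr => j _; rewrite ![X.1 _ _ * _]mulrC ![X.2 _ _ * _]mulrC.
Qed.

Lemma drow_neq0 p : M p -> drow p != 0.
Proof.
move=> Mp; have [v] := drho_neq0 Mp; apply: contra => /eqP d0; apply/eqP.
have Up := M_U Mp; have dr : differentiable rho p by exact: smooth_differentiable Up.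
rewrite diff_coord// big1// => j _.
have : rho_ rho j p = 0 by have /rowP/(_ j) := d0; rewrite !mxE.
rewrite /rho_ /dz /cderive /= (_ : (fun q => rho q) = rho)// !(derive_cst _).
move: ('D_(dx_dir j) rho p) ('D_(dy_dir j) rho p) => x y.
rewrite halfC.
move=> /eqP; rewrite eq_complex /= => /andP[/eqP xx /eqP yy].
have -> : x = 0 by lra.
have -> : y = 0 by lra.
by rewrite !mulr0 addr0.
Qed.

(** This makes it legitimate to compute with arbitrary extensions of fields and
    forms off [M]: identities between them hold on [M] only, but may be
    differentiated in tangent directions. *)
Lemma vact_tangentM W f g p X : open W -> W p -> M p ->
  cdiff f p -> cdiff g p -> CTM rho p X ->
  (forall q, W q -> M q -> f q = g q) -> vact X f p = vact X g p.
Proof.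
move=> Wo Wp Mp df dg /CTM_vact Xr fg.
have [w rw] := drho_neq0 Mp.
have dgN : cdiff (fun q => -1 * g q) p by apply: cdiffM => //; exact: cdiff_cst.
apply/eqP; rewrite -subr_eq0 -mulN1r -vact_cstM// -vactD//; apply/eqP.
have dfg : cdiff (fun q => f q + -1 * g q) p by exact: cdiffD.
apply: (vact_tangent dfg _ (M_rho Mp) rw Xr).
- by apply: filterS (near_U (M_U Mp)) => q; exact: smooth_differentiable.
- have Wn : \forall q \near p, W q by exact: open_nbhs_nbhs.
  apply: filterS2 Wn (near_U (M_U Mp)) => q Wq Uq rq.
  by rewrite fg// mulN1r subrr.
Qed.

Lemma rowD_tangentM W y z p X : open W -> W p -> M p ->
  rdiff y p -> rdiff z p -> CTM rho p X ->
  (forall q, W q -> M q -> y q = z q) -> rowD X y p = rowD X z p.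
Proof.
move=> Wo Wp Mp dy dz XT yz; apply/rowP => j; rewrite !mxE.
by apply: (vact_tangentM Wo) => // q Wq Mq; rewrite yz.
Qed.

(** If [g p] were nonzero, the bound would fail near [p] off [M], so a neighbourhood
    of [p] would lie in [M]; there [rho] vanishes, against [d rho <> 0]. *)
Lemma bound_by_rho_eq0 (g : Cpoint R n -> R) p : M p ->
  {for p, continuous g} ->
  (\forall q \near p, ~ M q -> `|g q| <= `|rho q|) -> g p = 0.
Proof.
move=> Mp gc gM; apply/eqP; apply: contraT => gp0.
have Up := M_U Mp; have dr : differentiable rho p by exact: smooth_differentiable Up.
have c : {for p, continuous (fun q => `|g q| - `|rho q|)}.
  have rc := differentiable_continuous dr.
  by apply: cvgB; apply: cvg_norm.
have pos : \forall q \near p, 0 < `|g q| - `|rho q|.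
  have := cvgr_gt _ c; apply.
  by rewrite (M_rho Mp) normr0 subr0 normr_gt0.
have r0 : {near p, rho =1 cst 0}.
  apply: filterS2 gM pos => q gq pq.
  have [/M_rho//|/gq H] := pselect (M q).
  by exfalso; move: pq; rewrite subr_gt0 ltNge H.
have [v /eqP] := drho_neq0 Mp; case.
by rewrite -deriveE// (near_eq_derive _ r0) derive_cst.
Qed.

(** The quotient in the hypothesis is at most 1 in modulus near [p] off [M], and
    the mixed Hessian is continuous. *)
Lemma rho11E p j k : M p -> rho11_ rho j k p = a j k.
Proof.
move=> Mp; have Up := M_U Mp.
have [c1 c2] : cdiff (rho11_ rho j k) p.
  exact: csmooth_cdiff (csmooth_dz U_open j (rhobar_csmooth k)) Up.
have bnd : \forall q \near p, ~ M q -> `|rho11_ rho j k q - a j k| <= `|(rho q)%:C|.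
  have : \forall q \near p, ~ M q -> `|(rho11_ rho j k q - a j k) / (rho q)%:C| < 1.
    exact: @cvgr0_norm_lt C C^o _ _ _
    (fun q => (rho11_ rho j k q - a j k) / (rho q)%:C) (rho_a Mp j k) 1 ltr01.
  apply: filterS2 (near_U Up) => q Uq H Mq.
  have r0 : rho q != 0 by apply/eqP => rq; apply: Mq.
  have := H Mq; rewrite normrM normfV => /ltW.
  rewrite ler_pdivrMr ?mul1r// normr_gt0.
  by apply: contra r0 => /eqP[->].
have normcR (x : R) : `|x%:C| = `|x|%:C :> C.
  by rewrite normc_def /= expr0n addr0 sqrtr_sqr.
have normc_Im (z : C) : `|complex.Im z|%:C <= `|z|.
  have := normc_ge_Re (z * 'i%C); rewrite normrM.
  rewrite ReiNIm normrN (_ : `|'i%C : C| = 1) ?mulr1//.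
  by rewrite normc_def /= expr0n expr1n add0r sqrtr1.
suff [h1 h2] : complex.Re (rho11_ rho j k p - a j k) = 0 /\
               complex.Im (rho11_ rho j k p - a j k) = 0.
  apply/eqP; rewrite -subr_eq0; apply/eqP.
  by move: h1 h2; case: (_ - _) => x y /= -> ->.
have Re_sub q : complex.Re (rho11_ rho j k q - a j k)
    = complex.Re (rho11_ rho j k q) - complex.Re (a j k).
  by rewrite Re_add; case: (a j k).
have Im_sub q : complex.Im (rho11_ rho j k q - a j k)
    = complex.Im (rho11_ rho j k q) - complex.Im (a j k).
  by rewrite Im_add; case: (a j k).
split.
- apply: (bound_by_rho_eq0 (g := fun q => complex.Re (rho11_ rho j k q - a j k)) Mp).
    rewrite (_ : (fun q => _) = (fun q => complex.Re (rho11_ rho j k q) - complex.Re (a j k))).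
      by apply: cvgB; [exact: (differentiable_continuous c1)|exact: cvg_cst].
    by apply/funext => q; rewrite Re_sub.
  apply: filterS bnd => q H /H; rewrite normcR => /(le_trans (normc_ge_Re _)).
  by rewrite lecR.
- apply: (bound_by_rho_eq0 (g := fun q => complex.Im (rho11_ rho j k q - a j k)) Mp).
    rewrite (_ : (fun q => _) = (fun q => complex.Im (rho11_ rho j k q) - complex.Im (a j k))).
      by apply: cvgB; [exact: (differentiable_continuous c2)|exact: cvg_cst].
    by apply/funext => q; rewrite Im_sub.
  apply: filterS bnd => q H /H; rewrite normcR => /(le_trans (normc_Im _)).
  by rewrite lecR.
Qed.

Lemma dzbar_rho p j k : M p -> dzbar j (rho_ rho k) p = a k j.
Proof.
move=> Mp; have Up := M_U Mp.
rewrite -[LHS]conjcK -dz_conj; last exact: rho_cdiff.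
rewrite a_herm -(rho11E j k Mp) /rho11_ /dz; congr ((_ * (_ - _ * _))^*%C).
- apply: cderive_ext; apply: filterS (near_U Up) => q Uq.
  by rewrite rhobarE.
- apply: cderive_ext; apply: filterS (near_U Up) => q Uq.
  by rewrite rhobarE.
Qed.

Definition hess2 p (x y : row) : C := \sum_j \sum_k rho2_ rho j k p * x 0 j * y 0 k.

(** On [M] the mixed second derivatives of [rho] are the metric, so that only its
    holomorphic Hessian remains free. *)
Lemma rowD_drow p X y : M p ->
  pairing (rowD X drow p) y = hess2 p X.1 y + bil a y X.2.
Proof.
move=> Mp.
have E k : rowD X drow p 0 k =
    \sum_j (X.1 0 j * rho2_ rho j k p + X.2 0 j * a k j).
  rewrite mxE (_ : (fun q => drow q 0 k) = rho_ rho k); last first.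
    by apply/funext => q; rewrite mxE.
  by apply: eq_bigr => j _; rewrite dzbar_rho.
rewrite /pairing /hess2 [X in X + _]exchange_big -big_split; apply: eq_bigr => k _ /=.
rewrite E big_split mulrDl !mulr_suml; congr (_ + _); apply: eq_bigr => j _.
  by rewrite [X.1 0 j * _]mulrC.
by rewrite [X.2 0 j * _]mulrC mulrAC.
Qed.

Lemma rho2_sym p j k : U p -> rho2_ rho j k p = rho2_ rho k j p.
Proof.
move=> Up.
have s v : smooth_on U ('D_v rho) by exact: smooth_derive.
have dv v q : U q -> differentiable ('D_v rho) q by exact: smooth_differentiable.
have E i q : rho_ rho i q = (2^-1 * 'D_(dx_dir i) rho q) -i*
                            (2^-1 * 'D_(dy_dir i) rho q).
  rewrite /rho_ /dz /cderive /= (_ : (fun q => rho q) = rho)// !(derive_cst _).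
  move: ('D_(dx_dir i) rho q) ('D_(dy_dir i) rho q) => x y.
  rewrite halfC.
  by apply/eqP; rewrite eq_complex /=; apply/andP; split; apply/eqP; ring.
have dr : \forall q \near p, differentiable rho q.
  by apply: filterS (near_U Up) => q; exact: smooth_differentiable.
have [D2 D2E D2C] : exists2 D2 : Cpoint R n -> Cpoint R n -> R,
    forall u v, 'D_u ('D_v rho) p = D2 u v & forall u v, D2 u v = D2 v u.
  exists (fun u v => 'D_u ('D_v rho) p) => u v; first exact: erefl.
  exact (derive_comm dr (dv v p Up) (dv u p Up)).
have F i v : cderive v (rho_ rho i) p =
    (2^-1 * D2 v (dx_dir i)) -i* (2^-1 * D2 v (dy_dir i)).
  rewrite -!D2E /cderive; congr (_ +i* _).
    rewrite (_ : (fun q => _) = (fun q => 2^-1 *: 'D_(dx_dir i) rho q)).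
      by rewrite deriveZ//; apply: diff_derivable; exact: dv.
    by apply/funext => q; rewrite E.
  rewrite (_ : (fun q => _) = (fun q => (- 2^-1) *: 'D_(dy_dir i) rho q)).
    by rewrite deriveZ ?scaleNr//; apply: diff_derivable; exact: dv.
  by apply/funext => q; rewrite E /= -mulNr.
rewrite /rho2_ /dz !F.
rewrite (D2C (dx_dir j) (dx_dir k)) (D2C (dx_dir j) (dy_dir k)).
rewrite (D2C (dy_dir j) (dy_dir k)) (D2C (dx_dir k) (dy_dir j)).
congr (_ * _); apply/eqP; rewrite eq_complex /=.
by apply/andP; split; apply/eqP; ring.
Qed.

Lemma hess2_sym p x y : U p -> hess2 p x y = hess2 p y x.
Proof.
move=> Up; rewrite /hess2 exchange_big; apply: eq_bigr => j _; apply: eq_bigr => k _.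
by rewrite rho2_sym// mulrAC.
Qed.

Lemma rowD_theta1 p X : rowD X (fun q => (i_dbar_rho rho q).1) p = 0.
Proof.
apply/rowP => j; rewrite [RHS]mxE [LHS]mxE.
rewrite (_ : (fun q => (i_dbar_rho rho q).1 0 j) = (fun=> 0)) ?vact_cst//.
by apply/funext => q; rewrite mxE.
Qed.

Lemma rowD_theta2 p X : U p -> rowD X (fun q => (i_dbar_rho rho q).2) p =
  'i%C *: conjr (rowD (conjv X) drow p).
Proof.
move=> Up; rewrite -rowD_conj; last exact: drow_rdiff.
rewrite conjvK; apply/rowP => j; rewrite !mxE.
rewrite (_ : (fun q => _) = (fun q => 'i%C * rhobar_ rho j q)); last first.
  by apply/funext => q; rewrite mxE.
rewrite vact_cstM; last exact: rhobar_cdiff.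
congr (_ * _); apply: vact_ext; apply: filterS (near_U Up) => q Uq.
by rewrite !mxE rhobarE.
Qed.

(** The antiholomorphic Hessian of [rho] is symmetric and cancels in the exterior
    derivative of [i dbar rho]; the mixed Hessian is the metric. *)
Lemma dtheta_kahler p X Y : M p ->
  dform (i_dbar_rho rho) p X Y = kahler_form a X Y.
Proof.
move=> Mp; have Up := M_U Mp.
have E X' Y' : form_eval (flatD X' (i_dbar_rho rho) p) Y' =
   'i%C * ((hess2 p (conjr X'.2) (conjr Y'.2))^*%C + bil a X'.1 Y'.2).
  rewrite form_evalE flatDE /= rowD_theta1 rowD_theta2// pairC pair0r add0r.
  rewrite pairC pairZr pairC -[Y'.2]conjrK pair_conj rowD_drow// rmorphD /=.
  by rewrite bil_conj// !conjrK.
rewrite /dform !E kahler_formE hess2_sym//.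
by move: (hess2 _ _ _)^*%C => h; ring.
Qed.

(** * The second fundamental form *)

Hypothesis a_pos : forall v : row, v != 0 -> 0 < bil a v (conjr v).

(** The fibre at [p] of the complexified contact bundle. *)
Definition HC p X := pairing (drow p) X.1 = 0 /\ pairing (conjr (drow p)) X.2 = 0.

Lemma HC_CTM p X : U p -> HC p X -> CTM rho p X.
Proof. by move=> Up [h1 h2]; apply/CTME => //; rewrite h1 h2 addr0. Qed.

Lemma HC_conj p X : HC p X -> HC p (conjv X).
Proof.
move=> [h1 h2]; split; rewrite conjvE /=; last by rewrite pair_conj h1 conjc0.
by rewrite -[drow p]conjrK pair_conj h2 conjc0.
Qed.

Lemma T10M_HC p X : U p -> T10M rho p X -> pairing (drow p) X.1 = 0 /\ X.2 = 0.
Proof.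
move=> Up [/CTME + X2]; rewrite X2 pair0r addr0 => H; split => //.
exact: H.
Qed.

Lemma theta_eval p X : U p ->
  form_eval (i_dbar_rho rho p) X = 'i%C * pairing (conjr (drow p)) X.2.
Proof.
move=> Up; rewrite form_evalE pairC pair0r add0r.
have -> : (i_dbar_rho rho p).2 = 'i%C *: conjr (drow p).
  by apply/rowP => k; rewrite !mxE rhobarE.
by rewrite pairC pairZr pairC.
Qed.

(** These equations characterise [i xi - i conj xi]; the last one is the
    contraction of [d theta], which is the Kaehler form, with [conj x]. *)
Lemma Reeb_type p (T : Cvec R n) : M p ->
  CTM rho p T -> form_eval (i_dbar_rho rho p) T = 1 ->
  (forall X, CTM rho p X -> dform (i_dbar_rho rho) p T X = 0) ->
  [/\ pairing (drow p) T.1 = 'i%C, pairing (conjr (drow p)) T.2 = - 'i%C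
    & forall x, pairing (drow p) x = 0 -> bil a T.1 (conjr x) = 0].
Proof.
move=> Mp; have Up := M_U Mp; move=> TM; rewrite theta_eval// => T1 TX.
have T2 : pairing (conjr (drow p)) T.2 = - 'i%C.
  by apply: (mulfI i_neq0); rewrite T1 mulrN ii_mul opprK.
split => //.
  by move: TM => /CTME -/(_ Up) /eqP; rewrite T2 subr_eq0 => /eqP.
move=> x lx; have := TX (0, conjr x); rewrite dtheta_kahler// kahler_formE /=.
rewrite bil0l subr0 => H; apply: (mulfI i_neq0); rewrite mulr0 H//.
by apply/CTME => //=; rewrite pair0r add0r pair_conj lx conjc0.
Qed.

Section TanakaWebster.
Variables (W : set (Cpoint R n)) (d : @tw_data R n).
Hypotheses (Wo : open W) (WU : W `<=` U).
Hypothesis tw : is_tanaka_webster U rho (i_dbar_rho rho) W d.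

Local Notation z al q := (tw_Z d al q).1.
Local Notation zf al := (fun q => (tw_Z d al q).1).
Local Notation th1 al p := (tw_th d al p).1.
Local Notation th2 al p := (tw_th d al p).2.

Variable p : Cpoint R n.
Hypotheses (Wp : W p) (Mp : M p).
Let Up : U p := WU Wp.

Let frame := tw_frameP tw.

Lemma frame_T10 al q : W q -> M q ->
  pairing (drow q) (z al q) = 0 /\ (tw_Z d al q).2 = 0.
Proof.
move=> Wq Mq; have [_ /(_ q Wq Mq)[T10 _]] := frame.
by apply: T10M_HC (T10 al); exact: WU.
Qed.

Lemma z_rdiff al : rdiff (zf al) p.
Proof. by have [Zs _] := frame; exact: vsmooth_rdiff1 (Zs al) Wp. Qed.

Lemma th1_rdiff al : rdiff (fun q => th1 al q) p.
Proof. exact: vsmooth_rdiff1 (tw_th_smooth tw al) Wp. Qed.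

Lemma th2_rdiff al : rdiff (fun q => th2 al q) p.
Proof. exact: vsmooth_rdiff2 (tw_th_smooth tw al) Wp. Qed.

Lemma th1_z al be q : W q -> M q -> pairing (th1 al q) (z be q) = (al == be)%:R.
Proof.
move=> Wq Mq; have [<- _ _] := tw_dual tw Wq Mq al be.
by rewrite form_evalE (frame_T10 be Wq Mq).2 pair0r addr0.
Qed.

Lemma th2_z al be q : W q -> M q -> pairing (th2 al q) (conjr (z be q)) = 0.
Proof.
move=> Wq Mq; have [_ <- _] := tw_dual tw Wq Mq al be.
by rewrite form_evalE conjvE /= (frame_T10 be Wq Mq).2 conjr0 pair0r add0r.
Qed.

Lemma frame_span q x : W q -> M q -> pairing (drow q) x = 0 ->
  x = \sum_al pairing (th1 al q) x *: z al q.
Proof.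
move=> Wq Mq lx; have [_ /(_ q Wq Mq)[_ Zf]] := frame.
have zl al : pairing (drow q) (z al q) = 0 by have [] := frame_T10 al Wq Mq.
have [c xE] := span_hyperplane (drow_neq0 Mq) Zf zl lx.
rewrite {1}xE; apply: eq_bigr => al _; congr (_ *: _).
rewrite xE pair_sumr (bigD1 al)//= big1 => [|be /negbTE ne].
  by rewrite pairZr th1_z// eqxx mulr1 addr0.
by rewrite pairZr th1_z// eq_sym ne mulr0.
Qed.

Lemma th2_ker al q x : W q -> M q -> pairing (conjr (drow q)) x = 0 ->
  pairing (th2 al q) x = 0.
Proof.
move=> Wq Mq lx; have : pairing (drow q) (conjr x) = 0.
  by rewrite -[drow q]conjrK pair_conj lx conjc0.
move=> /(frame_span Wq Mq) xE; rewrite -[x]conjrK xE conjr_sum pair_sumr.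
by rewrite big1// => be _; rewrite conjrZ pairZr th2_z// mulr0.
Qed.

Lemma frame_orth x : (forall al, bil a x (conjr (z al p)) = 0) ->
  x = pairing (drow p) x *: xi a (drow p).
Proof.
move=> xz; have [_ /(_ p Wp Mp)[_ Zf]] := frame.
apply: (orthogonal_xi a_pos (drow_neq0 Mp) Zf) => // al.
by have [] := frame_T10 al Wp Mp.
Qed.

(** The (1,0) part of [II (X, Z_al)]. *)
Definition II_frame al X : row := rowD X (zf al) p
  - \sum_be form_eval (tw_omega d al be p) X *: z be p.

Lemma II_frameD al X Y : II_frame al (X + Y) = II_frame al X + II_frame al Y.
Proof.
rewrite /II_frame rowDDl addrACA -opprD -big_split; congr (_ - _).
by apply: eq_bigr => be _; rewrite form_evalD scalerDl.
Qed.

Lemma II_frameZ al (k : C) X : II_frame al (k *: X) = k *: II_frame al X.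
Proof.
rewrite /II_frame rowDZl scalerBr scaler_sumr; congr (_ - _).
by apply: eq_bigr => be _; rewrite form_evalZ scalerA.
Qed.

Lemma II_frame_sum al (I : Type) (r : seq I) (F : I -> Cvec R n) :
  II_frame al (\sum_(i <- r) F i) = \sum_(i <- r) II_frame al (F i).
Proof.
apply: (big_morph (II_frame al)) => [X Y|]; first exact: II_frameD.
by rewrite -(scale0r (0 : Cvec R n)) II_frameZ scale0r.
Qed.

Lemma rowD_z_drow al X : CTM rho p X ->
  pairing (drow p) (rowD X (zf al) p) = - pairing (rowD X drow p) (z al p).
Proof.
move=> XT; apply/eqP; rewrite -addr_eq0 addrC -vact_pair; last 2 first.
- exact: drow_rdiff.
- exact: z_rdiff.
rewrite (vact_tangentM Wo Wp Mp (g := fun=> 0) _ _ XT) ?vact_cst//.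
- by apply: cdiff_pair; [exact: drow_rdiff|exact: z_rdiff].
- by move=> q Wq Mq; have [] := frame_T10 al Wq Mq.
Qed.

Lemma rowD_th1_z be de X : CTM rho p X ->
  pairing (rowD X (fun q => th1 be q) p) (z de p) = - pairing (th1 be p) (rowD X (zf de) p).
Proof.
move=> XT; apply/eqP; rewrite -addr_eq0 -vact_pair; last 2 first.
- exact: th1_rdiff.
- exact: z_rdiff.
rewrite (vact_tangentM Wo Wp Mp (g := fun=> (be == de)%:R) _ _ XT) ?vact_cst//.
- by apply: cdiff_pair; [exact: th1_rdiff|exact: z_rdiff].
- by move=> q Wq Mq; exact: th1_z.
Qed.

Lemma rowD_th2_z be de X : CTM rho p X ->
  pairing (rowD X (fun q => th2 be q) p) (conjr (z de p))
    = - pairing (th2 be p) (rowD X (fun q => conjr (z de q)) p).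
Proof.
have zc : rdiff (fun q => conjr (z de q)) p by apply: rdiff_conj; exact: z_rdiff.
move=> XT; apply/eqP; rewrite -addr_eq0 -vact_pair//; last exact: th2_rdiff.
rewrite (vact_tangentM Wo Wp Mp (g := fun=> 0) _ _ XT) ?vact_cst//.
- by apply: cdiff_pair => //; exact: th2_rdiff.
- by move=> q Wq Mq; exact: th2_z.
Qed.

Lemma HC_z al q : W q -> M q -> HC q (tw_Z d al q).
Proof. by move=> Wq Mq; have [h1 h2] := frame_T10 al Wq Mq; split=> //; rewrite h2 pair0r. Qed.

(** The structure equation says that [omega] on [conj Z_ga] is read off the bracket
    of [conj Z_ga] and [Z_de], whose only component outside the contact bundle is
    along the Reeb field. That field is orthogonal to the contact bundle, so
    [omega] is the tangential part of the flat derivative. *)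
Lemma II_frame_bar de ga al :
  bil a (II_frame de (conjv (tw_Z d ga p))) (conjr (z al p)) = 0.
Proof.
have [zd Yz2] := frame_T10 de Wp Mp; have [zg Xz2] := frame_T10 ga Wp Mp.
have [X XE] : exists X, X = conjv (tw_Z d ga p) by eexists.
have [Y YE] : exists Y, Y = tw_Z d de p by eexists.
rewrite -XE.
have X1 : X.1 = 0 by rewrite XE conjvE /= Xz2 conjr0.
have X2 : X.2 = conjr (z ga p) by rewrite XE.
have Y1 : Y.1 = z de p by rewrite YE.
have Y2 : Y.2 = 0 by rewrite YE.
have HX : HC p X by rewrite XE; apply: HC_conj; exact: HC_z.
have HY : HC p Y by rewrite YE; exact: HC_z.
have XT := HC_CTM Up HX; have YT := HC_CTM Up HY.
(* The bracket of [conj Z_ga] and [Z_de] at [p] is [(V1, V2)]. *)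
pose V1 := rowD X (zf de) p; pose V2 := - rowD Y (fun q => conjr (z ga q)) p.
pose m := bil a (z de p) (conjr (z ga p)).
have om be : form_eval (tw_omega d de be p) X = pairing (th1 be p) V1 + pairing (th2 be p) V2.
  have := tw_structure tw Wp Mp XT YT be.
  rewrite /dform !form_evalE !flatDE /= Y2 X1 !pair0r !(addr0, add0r).
  rewrite X2 Y1 rowD_th1_z// rowD_th2_z//.
  rewrite [X in _ = _ + X]big1 ?addr0; last first.
    move=> ga' _; rewrite /wedge_form !theta_eval// HX.2 HY.2.
    by rewrite !mulr0 !mul0r subrr mulr0.
  rewrite (bigD1 de)//= big1 ?addr0 => [|be' ne].
    rewrite /wedge_form !form_evalE X1 X2 Y1 Y2 !pair0r th1_z// th2_z// eqxx.
    rewrite !(addr0, add0r) mul0r mul1r sub0r => H.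
    apply: oppr_inj; rewrite -H.
    by rewrite /V1 /V2 pairNr opprD.
  rewrite /wedge_form !form_evalE X1 X2 Y1 Y2 !pair0r th1_z// th2_z//.
  by rewrite eq_sym in ne; rewrite eq_sym (negbTE ne) !(addr0, add0r) !mul0r subrr.
have V1l : pairing (drow p) V1 = - m.
  rewrite rowD_z_drow// rowD_drow// X1 X2 /hess2 big1 ?add0r// => j _.
  by rewrite big1// => k _; rewrite mxE mulr0 mul0r.
have V2l : pairing (conjr (drow p)) V2 = m.
  have cz : rowD Y (fun q => conjr (z ga q)) p = conjr (rowD (conjv Y) (zf ga) p).
    by rewrite -rowD_conj ?conjvK//; exact: z_rdiff.
  have YcT : CTM rho p (conjv Y) by apply: HC_CTM => //; exact: HC_conj.
  rewrite /V2 cz pairNr pair_conj rowD_z_drow// rowD_drow// conjvE /= Y1 Y2 conjr0.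
  rewrite /hess2 big1 ?add0r => [|j _]; last first.
    by rewrite big1// => k _; rewrite mxE mulr0 mul0r.
  by rewrite rmorphN opprK /= bil_conj// !conjrK.
have BE : II_frame de X = V1 - \sum_be form_eval (tw_omega d de be p) X *: z be p by [].
clearbody V1 V2.
have [TM _ T1 TX] := (tw_ReebP tw).2 p Wp Mp.
have [Tl1 Tl2 Tz] := Reeb_type Mp TM T1 TX.
(* [c] is the component of the bracket along the Reeb field. *)
pose c := 'i%C * m; set T := tw_T d p in TM T1 TX Tl1 Tl2 Tz.
have K1 : pairing (drow p) (V1 - c *: T.1) = 0.
  by rewrite pairDr pairNr pairZr V1l Tl1 /c mulrAC ii_mul mulN1r opprK addNr.
have K2 : pairing (conjr (drow p)) (V2 - c *: T.2) = 0.
  by rewrite pairDr pairNr pairZr V2l Tl2 /c mulrN mulrAC ii_mul mulN1r opprK subrr.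
have omz : \sum_be form_eval (tw_omega d de be p) X *: z be p = V1 - c *: T.1.
  rewrite (frame_span Wp Mp K1); apply: eq_bigr => be _; congr (_ *: _).
  have [_ _ thT] := tw_dual tw Wp Mp be be; rewrite form_evalE in thT.
  have := th2_ker be Wp Mp K2; rewrite om !pairDr !pairNr !pairZr.
  move=> /eqP; rewrite subr_eq0 => /eqP ->.
  by move: thT => /eqP; rewrite addrC addr_eq0 => /eqP ->; rewrite mulrN.
rewrite BE omz opprB addrC subrK bilZl Tz ?mulr0//.
by have [] := frame_T10 al Wp Mp.
Qed.

Lemma tw_hE al be q : W q -> M q ->
  tw_h d al be q = bil a (z al q) (conjr (z be q)).
Proof.
move=> Wq Mq; have Uq := WU Wq.
have XT : CTM rho q (tw_Z d al q) by apply: HC_CTM => //; exact: HC_z.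
have YT : CTM rho q (conjv (tw_Z d be q)).
  by apply: HC_CTM => //; apply: HC_conj; exact: HC_z.
have [_ z2] := frame_T10 al Wq Mq.
have K : kahler_form a (tw_Z d al q) (conjv (tw_Z d be q))
    = 'i%C * bil a (z al q) (conjr (z be q)).
  by rewrite kahler_formE conjvE /= z2 bil0r subr0.
have := tw_dtheta tw Wq Mq XT YT; rewrite dtheta_kahler// K => /(mulfI i_neq0) ->.
have thZ ga de : form_eval (tw_th d ga q) (tw_Z d de q) = (ga == de)%:R.
  by have [] := tw_dual tw Wq Mq ga de.
have thcZ ga de : form_eval (tw_th d ga q) (conjv (tw_Z d de q)) = 0.
  by have [] := tw_dual tw Wq Mq ga de.
have E ga de : wedge_form (tw_th d ga q) (conjv (tw_th d de q)) (tw_Z d al q)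
    (conjv (tw_Z d be q)) = (ga == al)%:R * (de == be)%:R.
  by rewrite /wedge_form form_eval_conj !thZ thcZ mul0r subr0 conjc_nat.
under eq_bigr do under eq_bigr do rewrite E.
rewrite (bigD1 al)//= [X in _ + X]big1 ?addr0 => [|ga /negbTE ne].
  rewrite (bigD1 be)//= big1 ?addr0 => [|de /negbTE ne]; first by rewrite !eqxx !mulr1.
  by rewrite ne !mulr0.
by rewrite big1// => de _; rewrite ne mul0r mulr0.
Qed.

(** Both the Tanaka-Webster connection and the flat one are compatible with the
    metric; this exchanges [X] and [conj X], and so determines the derivatives
    along (1,0) vectors by those along (0,1) vectors. *)
Lemma II_frame_metric al be X : CTM rho p X -> CTM rho p (conjv X) ->
  bil a (II_frame al X) (conjr (z be p)) =
  - (bil a (II_frame be (conjv X)) (conjr (z al p)))^*%C.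
Proof.
move=> XT XcT; apply/eqP; rewrite -addr_eq0; apply/eqP.
have zc : rdiff (fun q => conjr (z be q)) p by apply: rdiff_conj; exact: z_rdiff.
have := tw_metric tw Wp Mp XT al be.
rewrite (vact_tangentM Wo Wp Mp (g := fun q => bil a (z al q) (conjr (z be q))) _ _ XT).
- rewrite vact_bil//; last exact: z_rdiff.
  rewrite -[in rowD X (fun q => conjr _)](conjvK X) rowD_conj; last exact: z_rdiff.
  rewrite big_split /= => H.
  rewrite /II_frame !bilDl !bilNl rmorphB /= !bil_conj// !conjrK.
  rewrite addrACA H -opprD; apply/eqP; rewrite subr_eq0; apply/eqP; congr (_ + _).
    rewrite bil_suml; apply: eq_bigr => ga _.
    by rewrite bilZl tw_hE.
  rewrite conjr_sum bil_sumr; apply: eq_bigr => ga _.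
  rewrite conjrZ bilZr tw_hE// mulrC; congr (_ * _).
  by rewrite -form_eval_conj conjvK.
- exact: csmooth_cdiff (tw_h_smooth tw al be) Wp.
- by apply: cdiff_bil => //; exact: z_rdiff.
- by move=> q Wq Mq; exact: tw_hE.
Qed.

Lemma II_frame_bar_HC de al (x : row) : pairing (conjr (drow p)) x = 0 ->
  bil a (II_frame de (0, x)) (conjr (z al p)) = 0.
Proof.
move=> lx; have : pairing (drow p) (conjr x) = 0.
  by rewrite -[drow p]conjrK pair_conj lx conjc0.
move=> /(frame_span Wp Mp) xE.
have -> : (0, x) = \sum_ga (pairing (th1 ga p) (conjr x))^*%C *: conjv (tw_Z d ga p).
  rewrite [RHS]surjective_pairing; congr (_, _).
    rewrite (big_morph fst (id1 := 0) (op1 := +%R))// big1// => ga _.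
    by rewrite conjvE /= (frame_T10 ga Wp Mp).2 conjr0 scaler0.
  rewrite (big_morph snd (id1 := 0) (op1 := +%R))//.
  rewrite -[LHS]conjrK [X in conjr X]xE conjr_sum; apply: eq_bigr => ga _.
  by rewrite conjrZ.
rewrite II_frame_sum bil_suml big1// => ga _.
by rewrite II_frameZ bilZl II_frame_bar mulr0.
Qed.

Lemma II_frame_orth al be X : HC p X -> bil a (II_frame al X) (conjr (z be p)) = 0.
Proof.
move=> [h1 h2].
have -> : X = (X.1, 0) + (0, X.2).
  rewrite [LHS]surjective_pairing [RHS]surjective_pairing.
  by congr (_, _); rewrite /= ?addr0 ?add0r.
rewrite II_frameD bilDl II_frame_bar_HC// addr0 II_frame_metric; last 2 first.
- by apply: HC_CTM => //; split=> //=; rewrite pair0r.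
- by apply: HC_CTM => //; apply: HC_conj; split=> //=; rewrite pair0r.
rewrite conjvE /= conjr0 II_frame_bar_HC ?conjc0 ?oppr0//.
by rewrite pair_conj h1 conjc0.
Qed.

Section SecondFundamentalForm.
Variables (X Y : Cpoint R n -> Cvec R n).
Hypothesis Ys : vsmooth_on W Y.
Hypothesis YH : forall q, W q -> M q -> HC q (Y q).
Hypothesis XH : HC p (X p).

Let XT : CTM rho p (X p) := HC_CTM Up XH.

Local Notation y al := (fun q => form_eval (tw_th d al q) (Y q)).

Lemma y_cdiff al : cdiff (y al) p.
Proof.
rewrite (_ : y al = (fun q => pairing (th1 al q) (Y q).1 + pairing (th2 al q) (Y q).2)).
  apply: cdiffD; apply: cdiff_pair.
  - exact: th1_rdiff.
  - exact: vsmooth_rdiff1 Ys Wp.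
  - exact: th2_rdiff.
  - exact: vsmooth_rdiff2 Ys Wp.
by apply/funext => q; rewrite form_evalE.
Qed.

Lemma Y_expand q : W q -> M q ->
  (Y q).1 = \sum_al form_eval (tw_th d al q) (Y q) *: z al q.
Proof.
move=> Wq Mq; have [h1 h2] := YH Wq Mq.
rewrite [LHS](frame_span Wq Mq h1); apply: eq_bigr => al _.
by rewrite form_evalE (th2_ker al Wq Mq h2) addr0.
Qed.

Lemma vact_theta_Y :
  vact (X p) (fun q => form_eval (i_dbar_rho rho q) (Y q)) p = 0.
Proof.
have th_rd : rdiff (fun q => conjr (drow q)) p by apply: rdiff_conj; exact: drow_rdiff.
have Y2d := vsmooth_rdiff2 Ys Wp.
have Wn : \forall q \near p, W q by exact: open_nbhs_nbhs.
rewrite (@vact_ext _ _ _ _ (fun q => 'i%C * pairing (conjr (drow q)) (Y q).2)); last first.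
  by apply: filterS Wn => q Wq; rewrite theta_eval//; exact: WU.
rewrite vact_cstM; last exact: cdiff_pair.
rewrite (vact_tangentM Wo Wp Mp (g := fun=> 0) _ _ XT) ?vact_cst ?mulr0//.
- exact: cdiff_pair.
- by move=> q Wq Mq; have [] := YH Wq Mq.
Qed.

Lemma nabla1 : (tw_nabla (i_dbar_rho rho) d X Y p).1 =
  \sum_al (vact (X p) (y al) p + \sum_be y be p
             * form_eval (tw_omega d be al p) (X p)) *: z al p.
Proof.
rewrite /tw_nabla vact_theta_Y scale0r addr0 /= !fst_sum.
rewrite [X in _ + X]big1 ?addr0// => al _; rewrite conjvE /=.
by rewrite (frame_T10 al Wp Mp).2 conjr0 scaler0.
Qed.

Lemma rowD_Y1 : rowD (X p) (fun q => (Y q).1) p =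
  \sum_al (vact (X p) (y al) p *: z al p + y al p *: rowD (X p) (zf al) p).
Proof.
have dz al : rdiff (fun q => y al q *: z al q) p.
  by apply: rdiffZ; [exact: y_cdiff|exact: z_rdiff].
rewrite (rowD_tangentM Wo Wp Mp (z := fun q => \sum_al y al q *: z al q) _ _ XT).
- rewrite rowD_sum//; apply: eq_bigr => al _.
  by rewrite rowDZ//; [exact: y_cdiff|exact: z_rdiff].
- exact: vsmooth_rdiff1 Ys Wp.
- exact: rdiff_sum.
- exact: Y_expand.
Qed.

(** The derivatives of the components of [Y] cancel, and what remains is a
    combination of the [II_frame al], hence orthogonal to the contact bundle. Its
    coefficient along [xi] is found by differentiating [d rho (Y) = 0]. *)
Lemma second_ff1 : (second_ff (i_dbar_rho rho) d X Y p).1 =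
  - (hess2 p (X p).1 (Y p).1 + bil a (Y p).1 (X p).2) *: xi a (drow p).
Proof.
have SE : (second_ff (i_dbar_rho rho) d X Y p).1 =
    rowD (X p) (fun q => (Y q).1) p - (tw_nabla (i_dbar_rho rho) d X Y p).1 by [].
have SB : (second_ff (i_dbar_rho rho) d X Y p).1 = \sum_al y al p *: II_frame al (X p).
  rewrite SE nabla1 rowD_Y1 big_split /=.
  have -> : \sum_al (vact (X p) (y al) p + \sum_be y be p
             * form_eval (tw_omega d be al p) (X p)) *: z al p =
     \sum_al vact (X p) (y al) p *: z al p + \sum_al y al p *:
        \sum_be form_eval (tw_omega d al be p) (X p) *: z be p.
    rewrite -[RHS]/(_ + _); under eq_bigr do rewrite scalerDl.
    rewrite big_split; congr (_ + _).
    under eq_bigr do rewrite scaler_suml.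
    rewrite exchange_big; apply: eq_bigr => al _; rewrite scaler_sumr.
    by apply: eq_bigr => be _; rewrite scalerA.
  rewrite opprD addrACA subrr add0r -sumrB; apply: eq_bigr => al _.
  by rewrite -scalerBr.
rewrite [LHS]frame_orth => [|al].
  congr (_ *: _); rewrite SE pairDr pairNr nabla1 pair_sumr.
  rewrite [X in _ - X]big1 ?subr0 => [|al _]; last first.
    by rewrite pairZr (frame_T10 al Wp Mp).1 mulr0.
  apply/eqP; rewrite -addr_eq0 addrC -rowD_drow// -vact_pair.
  - rewrite (vact_tangentM Wo Wp Mp (g := fun=> 0) _ _ XT) ?vact_cst//.
    + apply: cdiff_pair; first exact: drow_rdiff.
      exact: vsmooth_rdiff1 Ys Wp.
    + by move=> q Wq Mq; have [] := YH Wq Mq.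
  - exact: drow_rdiff.
  - exact: vsmooth_rdiff1 Ys Wp.
rewrite SB bil_suml big1// => be _.
by rewrite bilZl II_frame_orth// mulr0.
Qed.

End SecondFundamentalForm.

(** The connection is real, since the second sum in its definition is the conjugate
    of the first and the Reeb field is real. This gives the (0,1) part of the
    second fundamental form from its (1,0) part. *)
Lemma second_ff_conj (X Y : Cpoint R n -> Cvec R n) :
  vsmooth_on W Y -> (forall q, W q -> M q -> HC q (Y q)) -> HC p (X p) ->
  second_ff (i_dbar_rho rho) d (fun q => conjv (X q)) (fun q => conjv (Y q)) p
  = conjv (second_ff (i_dbar_rho rho) d X Y p).
Proof.
move=> Ys YH XH.
have Y1d := vsmooth_rdiff1 Ys Wp; have Y2d := vsmooth_rdiff2 Ys Wp.
have cYH q : W q -> M q -> HC q (conjv (Y q)) by move=> Wq Mq; apply: HC_conj; exact: YH.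
have cth al : cdiff (fun q => form_eval (conjv (tw_th d al q)) (Y q)) p.
  rewrite (_ : (fun q => _) = (fun q => (form_eval (tw_th d al q) (conjv (Y q)))^*%C)).
    by apply: cdiff_conj; exact (y_cdiff (conjv_smooth Wo Ys) al).
  by apply/funext => q; rewrite -form_eval_conj conjvK.
rewrite /second_ff conjvD conjvN; congr (_ - _).
  rewrite !flatDE [RHS]conjvE /=.
  by rewrite -!rowD_conj//; congr (_, _).
have cXH : HC p (conjv (X p)) by exact: HC_conj.
have thY := vact_theta_Y Ys YH XH.
have thcY := vact_theta_Y (X := fun q => conjv (X q)) (conjv_smooth Wo Ys) cYH cXH.
rewrite /tw_nabla thY thcY.
rewrite !scale0r !addr0 conjvD !conjv_sum addrC.
congr (_ + _); apply: eq_bigr => al _; rewrite conjvZ ?conjvK.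
  congr (_ *: _); rewrite rmorphD /=; congr (_ + _).
    rewrite -vact_conj; last exact: y_cdiff.
    apply: vact_ext; apply: filterE => q.
    by rewrite -form_eval_conj.
  by rewrite rmorph_sum; apply: eq_bigr => be _; rewrite rmorphM /= -!form_eval_conj.
congr (_ *: _); rewrite rmorphD /=; congr (_ + _).
  rewrite -vact_conj//.
  apply: vact_ext; apply: filterE => q.
  by rewrite -form_eval_conj conjvK.
by rewrite rmorph_sum; apply: eq_bigr => be _; rewrite rmorphM /= -!form_eval_conj !conjvK.
Qed.

Lemma second_ff2 (X Y : Cpoint R n -> Cvec R n) :
  vsmooth_on W Y -> (forall q, W q -> M q -> HC q (Y q)) -> HC p (X p) ->
  (second_ff (i_dbar_rho rho) d X Y p).2 =
  - (hess2 p (conjr (X p).2) (conjr (Y p).2) + bil a (conjr (Y p).2) (conjr (X p).1))^*%C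
    *: conjr (xi a (drow p)).
Proof.
move=> Ys YH XH.
have := second_ff1 (X := fun q => conjv (X q)) (conjv_smooth Wo Ys)
  (fun q Wq Mq => HC_conj (YH q Wq Mq)) (HC_conj XH).
rewrite second_ff_conj// conjvE /= => H.
by rewrite -[LHS]conjrK H conjrZ rmorphN.
Qed.

Lemma drow_sum q (x : row) : \sum_j rho_ rho j q * x 0 j = pairing (drow q) x.
Proof. by apply: eq_bigr => j _; rewrite mxE. Qed.

Lemma hess20l q x : hess2 q 0 x = 0.
Proof.
by rewrite /hess2 big1// => j _; rewrite big1// => k _; rewrite mxE mulr0 mul0r.
Qed.

Local Notation xip := (xi a (drow p)).

Section Frame.
Variable E : 'I_n -> Cpoint R n -> Cvec R n.
Hypothesis Eu : is_unitary_frame U rho (i_dbar_rho rho) W E.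

Lemma unitary_T10 al q : W q -> M q -> pairing (drow q) (E al q).1 = 0 /\ (E al q).2 = 0.
Proof.
move=> Wq Mq; have [[_ /(_ q Wq Mq)[T10 _]] _] := Eu.
by apply: T10M_HC (T10 al); exact: WU.
Qed.

Lemma unitary_bil al be q : W q -> M q ->
  bil a (E al q).1 (conjr (E be q).1) = (al == be)%:R.
Proof.
move=> Wq Mq; have [_ /(_ q Wq Mq al be)] := Eu.
rewrite dtheta_kahler// kahler_formE conjvE /= (unitary_T10 al Wq Mq).2 bil0r subr0.
by move=> /(mulfI i_neq0).
Qed.

(** By [second_ff1] each [II (conj E_al, E_al)] is [- |E_al|^2 xi], and its (0,1) part
    vanishes as [E_al] has type (1,0). *)
Lemma mean_curvE : (0 < n)%N ->
  mean_curv (i_dbar_rho rho) d E p = (- xip, 0).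
Proof.
move=> n0.
have H al : second_ff (i_dbar_rho rho) d (fun q => conjv (E al q)) (E al) p = (- xip, 0).
  have [[Es _] _] := Eu.
  have EH q : W q -> M q -> HC q (E al q).
    by move=> Wq Mq; have [h1 h2] := unitary_T10 al Wq Mq; split; rewrite ?h2 ?pair0r.
  have EcH : HC p (conjv (E al p)) by apply: HC_conj; exact: EH.
  rewrite [LHS]surjective_pairing.
  rewrite (second_ff1 (X := fun q => conjv (E al q)) (Es al) EH EcH).
  rewrite (second_ff2 (X := fun q => conjv (E al q)) (Es al) EH EcH).
  rewrite !conjvE /= (unitary_T10 al Wp Mp).2 conjr0 conjrK.
  rewrite hess20l bil0l add0r unitary_bil// eqxx scaleN1r.
  rewrite /hess2 big1 => [|j _]; last by rewrite big1// => k _; rewrite mxE mulr0.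
  by rewrite addr0 conjc0 oppr0 scale0r.
rewrite /mean_curv (eq_bigr (fun=> (- xip, 0))) => [|al _]; last exact: H.
rewrite [LHS]surjective_pairing /= fst_sum.
rewrite (big_morph snd (id1 := 0) (op1 := +%R))//= !sumr_const card_ord.
rewrite mul0rn scaler0 -(scaler_nat n (- xip)) scalerA mulVf ?scale1r//.
by rewrite pnatr_eq0 -lt0n.
Qed.

Lemma mu_vecE : (0 < n)%N ->
  mu_vec (i_dbar_rho rho) d E p = (- 2^-1 *: xip, - 2^-1 *: conjr xip).
Proof.
move=> n0; rewrite /mu_vec mean_curvE// conjvE /= conjr0 conjrN.
rewrite [LHS]surjective_pairing /=.
by rewrite addr0 add0r !scalerN !scaleNr.
Qed.

Lemma xi_norm : bil a xip (conjr xip) = (grad2 a (drow p))^-1.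
Proof.
by rewrite bil_xi// pair_conj pair_xi ?conjc1 ?mulr1//; exact: drow_neq0.
Qed.

Lemma HessE eta : Hess rho p eta =
  2^-1 * ((hess2 p eta eta + bil a eta (conjr eta))
          + (hess2 p eta eta + bil a eta (conjr eta))^*%C).
Proof.
have bc : (bil a eta (conjr eta))^*%C = bil a eta (conjr eta).
  by rewrite bil_conj// conjrK.
rewrite rmorphD /= bc /Hess.
have -> : \sum_j \sum_k rho11_ rho j k p * eta 0 j * (eta 0 k)^*%C = bil a eta (conjr eta).
  by apply: eq_bigr => j _; apply: eq_bigr => k _; rewrite rho11E// mxE.
have -> : \sum_j \sum_k (complex.Re (rho2_ rho j k p * eta 0 j * eta 0 k))%:C =
    2^-1 * (hess2 p eta eta + (hess2 p eta eta)^*%C).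
  rewrite /hess2 rmorph_sum -big_split mulr_sumr; apply: eq_bigr => j _ /=.
  rewrite rmorph_sum -big_split mulr_sumr; apply: eq_bigr => k _ /=.
  by rewrite ReJ_add mulrC.
move: (hess2 _ _ _) (_^*%C) (bil _ _ _) => x y b.
by field.
Qed.

(** With [s = rho_jk Z^j Z^k + |Z|^2] one has [II (X, X) = - s xi - conj s conj xi]
    and [mu = - (xi + conj xi) / 2], so the product is [r] times the real part of
    [s], which is the Hessian. *)
Lemma h_formE (X : Cpoint R n -> Cvec R n) (Z : Cvec R n) : (0 < n)%N ->
  vsmooth_on W X -> (forall q, W q -> M q -> HM rho q (X q)) ->
  T10M rho p Z -> X p = Z + conjv Z ->
  let r := (grad2 a (drow p))^-1 in
  h_form (i_dbar_rho rho) a d E X X p = r / sqrtC (r / 2) * Hess rho p Z.1.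
Proof.
move=> n0 Xs XM ZT XZ r.
have [lZ Z2] := T10M_HC Up ZT.
have X1 : (X p).1 = Z.1 by rewrite XZ conjvE /= Z2 conjr0 addr0.
have X2 : (X p).2 = conjr Z.1 by rewrite XZ conjvE /= Z2 add0r.
have XH q : W q -> M q -> HC q (X q).
  move=> Wq Mq; have [Y YT ->] := XM q Wq Mq.
  have [lY Y2] := T10M_HC (WU Wq) YT.
  rewrite conjvE /=; split; rewrite /= Y2 ?conjr0 ?addr0 ?add0r//.
  by rewrite pair_conj lY conjc0.
have XHp := XH p Wp Mp.
have S1 := second_ff1 Xs XH XHp; have S2 := second_ff2 Xs XH XHp.
rewrite X1 X2 !conjrK in S1 S2.
have c2 : (- 2^-1 : C)^*%C = - 2^-1 by rewrite rmorphN fmorphV rmorph_nat.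
have mu1 : (mu_vec (i_dbar_rho rho) d E p).1 = - 2^-1 *: xip by rewrite mu_vecE.
have mu2 : (mu_vec (i_dbar_rho rho) d E p).2 = - 2^-1 *: conjr xip by rewrite mu_vecE.
have mu1c : (conjv (mu_vec (i_dbar_rho rho) d E p)).1 = - 2^-1 *: xip.
  by rewrite conjv1 mu2 conjrZ conjrK c2.
have mu2c : (conjv (mu_vec (i_dbar_rho rho) d E p)).2 = - 2^-1 *: conjr xip.
  by rewrite conjv2 mu1 conjrZ c2.
rewrite /h_form !metric_formE mu1c mu2c mu1 mu2 S1 S2 HessE.
move: (hess2 p Z.1 Z.1 + bil a Z.1 (conjr Z.1)) => s.
have := xi_norm; rewrite -/r; move: xip => x xx; rewrite !(bilZl, bilZr) xx.
have -> : - 2^-1 * (- 2^-1 * r) + - 2^-1 * (- 2^-1 * r) = r / 2 by field.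
move: (sqrtC _) => t; move: (s^*%C) => sc; ring.
Qed.

End Frame.
End TanakaWebster.

Lemma grad2V_gt0 p : M p -> 0 < (grad2 a (drow p))^-1.
Proof. by move=> Mp; rewrite invr_gt0; apply: grad2_gt0 => //; exact: drow_neq0. Qed.

Lemma h_factor_gt0 p : M p ->
  0 < (grad2 a (drow p))^-1 / sqrtC ((grad2 a (drow p))^-1 / 2).
Proof.
by move=> /grad2V_gt0 r0; rewrite divr_gt0// sqrtC_gt0 divr_gt0.
Qed.

Lemma C_convex_pseudohermitian_convex : (0 < n)%N -> C_convex U rho ->
  pseudohermitian_C_convex U rho (i_dbar_rho rho) a.
Proof.
move=> n0 Cc W Wo WU d tw E Eu X Xs XM p Wp Mp.
have [Z ZT XZ] := XM p Wp Mp.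
rewrite (h_formE Wo WU tw Wp Mp Eu n0 Xs XM ZT XZ).
rewrite pmulr_rge0; last exact: h_factor_gt0.
have [lZ _] := T10M_HC (M_U Mp) ZT.
by apply: Cc => //; rewrite drow_sum.
Qed.

(** * Existence of local data *)

Section SmoothGradient.
Variable W : set (Cpoint R n).
Hypotheses (Wo : open W) (WU : W `<=` U).

Lemma rsmooth_drow : rsmooth W drow.
Proof.
move=> j; have [s1 s2] := rho_csmooth j.
apply: (@csmooth_ext _ _ _ Wo (rho_ rho j)) => [q _|]; first by rewrite mxE.
by split=> s q Wq; [exact: s1 (WU Wq)|exact: s2 (WU Wq)].
Qed.

Lemma rsmooth_grad : rsmooth W (fun q => grad a (drow q)).
Proof. exact: (rsmooth_mul Wo (invmx a) (rsmooth_conj Wo rsmooth_drow)). Qed.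

Lemma csmooth_grad2 : csmooth_on W (fun q => grad2 a (drow q)).
Proof. exact: (csmooth_pairing Wo rsmooth_drow rsmooth_grad). Qed.

Lemma csmooth_rho2 j k : csmooth_on W (rho2_ rho j k).
Proof.
have [s1 s2] := csmooth_dz U_open j (rho_csmooth k).
by split=> s q Wq; [exact: s1 (WU Wq)|exact: s2 (WU Wq)].
Qed.

End SmoothGradient.

(** In a unitary frame [E] defined near [M] and orthogonal to the gradient of
    [rho], every ingredient of the Tanaka-Webster connection is explicit. *)
Section Construction.
Variables (W : set (Cpoint R n)) (E : 'I_n -> Cpoint R n -> row).
Hypotheses (Wo : open W) (WU : W `<=` U).
Hypothesis drow0 : forall q, W q -> drow q != 0.
Hypothesis Es : forall al, rsmooth W (E al).
Hypothesis EE : forall al be q, W q -> bil a (E al q) (conjr (E be q)) = (al == be)%:R.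
Hypothesis El : forall al q, W q -> pairing (drow q) (E al q) = 0.

Local Notation r q := ((grad2 a (drow q))^-1).
Local Notation theta := (i_dbar_rho rho).

Definition uZ al q : Cvec R n := (E al q, 0).
Definition uT q : Cvec R n :=
  ('i%C *: xi a (drow q), - 'i%C *: conjr (xi a (drow q))).
Definition uth al q : Cvec R n := (conjr (E al q) *m a^T, 0).
Definition uh (al be : 'I_n) (q : Cpoint R n) : C := (al == be)%:R.
(** On the contact bundle this is the projection of the flat derivative. The term
    in [theta] comes from the structure equation on the Reeb field [T], where
    [omega] is read off the bracket of [T] and [E al]; the derivative of [xi] along
    [E al] has component [r] along [E al]. *)
Definition uomega al be q : Cvec R n :=
  (\row_j bil a (\row_k dz j (fun q' => E al q' 0 k) q) (conjr (E be q)),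
   \row_j bil a (\row_k dzbar j (fun q' => E al q' 0 k) q) (conjr (E be q)))
  + (- ('i%C * r q * (al == be)%:R)) *: theta q.
(** Up to [i r], the torsion is the antiholomorphic Hessian of [rho] on the contact
    bundle. *)
Definition uA be al q : C := 'i%C * r q * (hess2 q (E al q) (E be q))^*%C.

Definition unitary_tw : tw_data := TWData uZ uT uth uh uomega uA.

Lemma xi_smooth : rsmooth W (fun q => xi a (drow q)).
Proof.
apply: rsmoothZ => //; last exact: rsmooth_grad.
apply: csmoothV => //; last exact: csmooth_grad2.
by move=> q Wq; rewrite gt_eqF// grad2_gt0// drow0.
Qed.

Lemma r_smooth : csmooth_on W (fun q => r q).
Proof.
apply: csmoothV => //; last exact: csmooth_grad2.
by move=> q Wq; rewrite gt_eqF// grad2_gt0// drow0.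
Qed.

Lemma r_real q : (r q)^*%C = r q.
Proof. by rewrite conjc_inv grad2_real. Qed.

Lemma theta_smooth : vsmooth_on W theta.
Proof.
move=> j; split.
  by apply: csmooth_ext (csmooth_cst Wo 0) => // q _; rewrite mxE.
apply: csmooth_ext (csmoothM Wo (csmooth_cst Wo 'i%C)
  (csmooth_conj Wo (rsmooth_drow Wo WU j))) => // q Wq.
by rewrite !mxE rhobarE//; exact: WU.
Qed.

Lemma uZ_smooth al : vsmooth_on W (uZ al).
Proof. by apply: vsmooth_pair => //; exact: rsmooth_cst. Qed.

Lemma uT_smooth : vsmooth_on W uT.
Proof.
apply: vsmooth_pair; apply: rsmoothZ => //; try exact: csmooth_cst.
  exact: xi_smooth.
by apply: rsmooth_conj => //; exact: xi_smooth.
Qed.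

Lemma uth_smooth al : vsmooth_on W (uth al).
Proof.
apply: vsmooth_pair; last exact: rsmooth_cst.
by apply: rsmooth_mul => //; exact: rsmooth_conj.
Qed.

Lemma uomega_smooth al be : vsmooth_on W (uomega al be).
Proof.
have ths := theta_smooth.
have cs : csmooth_on W (fun q => - ('i%C * r q * (al == be)%:R)).
  apply: csmoothN => //; apply: csmoothM => //; last exact: csmooth_cst.
  by apply: csmoothM => //; [exact: csmooth_cst|exact: r_smooth].
have Ebs : rsmooth W (fun q => conjr (E be q)) by exact: rsmooth_conj.
move=> j; have [t1 t2] := ths j; split.
- have ds : rsmooth W (fun q => \row_k dz j (fun q' => E al q' 0 k) q).
    by move=> k; apply: csmooth_ext (csmooth_dz Wo j (Es al k)) => // q _; rewrite mxE.
  apply: csmooth_ext (csmoothD Wo (csmooth_bil Wo a ds Ebs) (csmoothM Wo cs t1)) => // q _.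
  by rewrite !mxE.
- have ds : rsmooth W (fun q => \row_k dzbar j (fun q' => E al q' 0 k) q).
    by move=> k; apply: csmooth_ext (csmooth_dzbar Wo j (Es al k)) => // q _; rewrite mxE.
  apply: csmooth_ext (csmoothD Wo (csmooth_bil Wo a ds Ebs) (csmoothM Wo cs t2)) => // q _.
  by rewrite !mxE.
Qed.

Lemma uA_smooth be al : csmooth_on W (uA be al).
Proof.
apply: csmoothM => //.
  by apply: csmoothM => //; [exact: csmooth_cst|exact: r_smooth].
apply: csmooth_conj => //; apply: csmooth_sum => // j; apply: csmooth_sum => // k.
by apply: csmoothM; [|apply: csmoothM; [|exact: csmooth_rho2|exact: Es]|exact: Es].
Qed.

Lemma uth_eval al q X : form_eval (uth al q) X = bil a X.1 (conjr (E al q)).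
Proof.
rewrite form_evalE /= pairM_tr [X in _ + X]pairC pair0r.
by rewrite addr0.
Qed.

Lemma uthc_eval al q X :
  form_eval (conjv (uth al q)) X = (bil a (conjr X.2) (conjr (E al q)))^*%C.
Proof. by rewrite -[X in LHS]conjvK form_eval_conj uth_eval. Qed.

Lemma uomega_eval al be q X : form_eval (uomega al be q) X =
  bil a (rowD X (E al) q) (conjr (E be q))
  - 'i%C * r q * (al == be)%:R * form_eval (theta q) X.
Proof.
rewrite /uomega form_evalC form_evalD form_evalZ !(form_evalC X) mulNr.
congr (_ - _); rewrite form_evalE /= !(pairC _ X.1) !(pairC _ X.2).
have H (F : 'I_n.+1 -> row) (x : row) (y : row) :
    pairing x (\row_j bil a (F j) y) = bil a (\sum_j x 0 j *: F j) y.
  by rewrite bil_suml; apply: eq_bigr => j _; rewrite mxE bilZl.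
rewrite !H -bilDl; congr (bil a _ _); apply/rowP => k.
rewrite !mxE !summxE -big_split; apply: eq_bigr => j _.
by rewrite !mxE.
Qed.

Variable p : Cpoint R n.
Hypotheses (Wp : W p) (Mp : M p).
Let Up : U p := WU Wp.

Lemma E_rdiff al : rdiff (E al) p.
Proof. exact: rsmooth_rdiff (Es al) Wp. Qed.

Lemma Ec_rdiff al : rdiff (fun q => conjr (E al q)) p.
Proof. by apply: rdiff_conj; exact: E_rdiff. Qed.

Lemma rowD_orthonormal al be X :
  bil a (E al p) (rowD X (fun q => conjr (E be q)) p)
  = - bil a (rowD X (E al) p) (conjr (E be p)).
Proof.
apply/eqP; rewrite -addr_eq0 addrC -vact_bil; [|exact: E_rdiff|exact: Ec_rdiff].
rewrite (@vact_ext _ _ _ _ (fun=> (al == be)%:R)) ?vact_cst//.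
have Wn : \forall q \near p, W q by exact: open_nbhs_nbhs.
by apply: filterS Wn => q Wq; rewrite EE.
Qed.

Lemma rowD_Ec_drow be X :
  pairing (conjr (drow p)) (rowD X (fun q => conjr (E be q)) p) =
  - ((hess2 p (conjr X.2) (E be p))^*%C + bil a X.1 (conjr (E be p))).
Proof.
have rd : rdiff (fun q => conjr (drow q)) p by apply: rdiff_conj; exact: drow_rdiff.
have H : pairing (rowD X (fun q => conjr (drow q)) p) (conjr (E be p)) =
    (hess2 p (conjr X.2) (E be p))^*%C + bil a X.1 (conjr (E be p)).
  have -> : rowD X (fun q => conjr (drow q)) p = conjr (rowD (conjv X) drow p).
    by rewrite -rowD_conj ?conjvK//; exact: drow_rdiff.
  by rewrite pair_conj rowD_drow// rmorphD /= bil_conj// conjrK.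
rewrite -H; apply/eqP; rewrite -addr_eq0 addrC -vact_pair//; last exact: Ec_rdiff.
rewrite (@vact_ext _ _ _ _ (fun=> 0)) ?vact_cst//.
have Wn : \forall q \near p, W q by exact: open_nbhs_nbhs.
by apply: filterS Wn => q Wq; rewrite pair_conj El// conjc0.
Qed.

Lemma E_expand x : x = \sum_al bil a x (conjr (E al p)) *: E al p
                     + pairing (drow p) x *: xi a (drow p).
Proof.
apply: (orthonormal_expansion a_pos x (drow0 Wp)) => [al be|al].
  exact: EE.
exact: El.
Qed.

Lemma theta_CTM X : CTM rho p X -> pairing (drow p) X.1 = 'i%C * form_eval (theta p) X.
Proof.
move=> XT; have /eqP := (CTME X Up).1 XT; rewrite addr_eq0 => /eqP ->.
by rewrite theta_eval// mulrA ii_mul mulN1r.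
Qed.

Lemma theta_eval2 X :
  pairing (conjr (drow p)) X.2 = - ('i%C * form_eval (theta p) X).
Proof. by rewrite theta_eval// mulrA ii_mul mulN1r opprK. Qed.

Lemma unitary_is_frame : is_frame U rho W uZ.
Proof.
split=> [al|q Wq Mq]; first exact: uZ_smooth.
split=> [al|]; last first.
  by apply: (orthonormal_row_free (a := a)) => al be; exact: EE.
split=> //; apply/CTME; first exact: WU.
by rewrite /= El// pair0r addr0.
Qed.

Lemma unitary_is_Reeb : is_Reeb U rho theta W uT.
Proof.
split=> [|q Wq Mq]; first exact: uT_smooth.
have Uq := WU Wq; have lx := pair_xi a_pos (drow0 Wq).
have lxc : pairing (conjr (drow q)) (conjr (xi a (drow q))) = 1.
  by rewrite pair_conj lx conjc1.
split.
- apply/CTME => //=; move: (xi a (drow q)) lx lxc => x lx lxc.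
  by rewrite !pairZr lx lxc !mulr1 subrr.
- have cNi : (- 'i%C : C)^*%C = 'i%C by rewrite -conji conjcK.
  by rewrite /uT conjvE [X in (X, _)]conjrZ [X in (_, X)]conjrZ conjrK conji cNi.
- by rewrite theta_eval//= pairZr lxc mulr1 mulrN ii_mul opprK.
- move=> X XT; rewrite dtheta_kahler// kahler_formE /uT /= bilZl bilZr.
  have -> : bil a X.1 (conjr (xi a (drow q))) = r q * pairing (drow q) X.1.
    by rewrite -[LHS]conjcK bil_conj// conjrK bil_xi// conjc_mul r_real pair_conj conjcK.
  rewrite bil_xi//; have /eqP := (CTME X Uq).1 XT; rewrite addr_eq0 => /eqP ->.
  by rewrite !mulrN mulNr !opprK subrr mulr0.
Qed.

Lemma unitary_dual al be q : W q -> M q ->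
  [/\ form_eval (uth al q) (uZ be q) = (al == be)%:R,
      form_eval (uth al q) (conjv (uZ be q)) = 0
    & form_eval (uth al q) (uT q) = 0].
Proof.
move=> Wq Mq; split; rewrite uth_eval.
- by rewrite /uZ /= EE// eq_sym.
- by rewrite conjvE /= conjr0 bil0l.
- by rewrite /uT /= bilZl bil_xi// pair_conj El// conjc0 !mulr0.
Qed.

Lemma unitary_dtheta X Y : CTM rho p X -> CTM rho p Y ->
  dform theta p X Y = 'i%C * \sum_al \sum_be uh al be p *
    wedge_form (uth al p) (conjv (uth be p)) X Y.
Proof.
move=> XT YT; rewrite dtheta_kahler// kahler_formE; congr (_ * _).
have -> : \sum_al \sum_be uh al be p *
    wedge_form (uth al p) (conjv (uth be p)) X Y =
    \sum_al wedge_form (uth al p) (conjv (uth al p)) X Y.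
  apply: eq_bigr => al _; rewrite (bigD1 al)//= big1 ?addr0 => [|be ne].
    by rewrite /uh eqxx mul1r.
  by rewrite /uh eq_sym (negbTE ne) mul0r.
have H X' Y' : CTM rho p X' -> bil a X'.1 Y'.2 =
   \sum_al form_eval (uth al p) X' * form_eval (conjv (uth al p)) Y'
   + r p * form_eval (theta p) X' * form_eval (theta p) Y'.
  move=> XT'; rewrite [in LHS](E_expand X'.1) bilDl bil_suml bilZl bil_xi//.
  rewrite theta_CTM// theta_eval2; congr (_ + _).
    apply: eq_bigr => al _; rewrite bilZl uth_eval uthc_eval bil_conj// !conjrK.
    by [].
  move: (form_eval _ X') (form_eval _ Y') => x y.
  have -> : 'i%C * x * (r p * - ('i%C * y)) = - ('i%C * 'i%C) * r p * x * y by ring.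
  by rewrite ii_mul opprK mul1r.
rewrite !H// /wedge_form sumrB opprD addrACA [X in _ + X](_ : _ = 0) ?addr0//.
by rewrite -!mulrA [X in _ - _ * X]mulrC subrr.
Qed.

Lemma unitary_metric X al be : CTM rho p X ->
  vact X (uh al be) p =
  \sum_ga (form_eval (uomega al ga p) X * uh ga be p +
           uh al ga p * form_eval (conjv (uomega be ga p)) X).
Proof.
move=> XT; rewrite /uh vact_cst big_split /=.
rewrite (bigD1 be)//= [X in _ + X + _]big1 ?addr0 => [|ga /negbTE ->]; last by rewrite mulr0.
rewrite (bigD1 al)//= [X in _ + (_ + X)]big1 ?addr0 => [|ga ne]; last first.
  by rewrite eq_sym (negbTE ne) mul0r.
rewrite !eqxx mulr1 mul1r.
have -> : form_eval (conjv (uomega be al p)) X = (form_eval (uomega be al p) (conjv X))^*%C.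
  by rewrite -form_eval_conj conjvK.
rewrite (uomega_eval al be p X) (uomega_eval be al p (conjv X)) conjc_sub.
have -> : (bil a (rowD (conjv X) (E be) p) (conjr (E al p)))^*%C =
    bil a (E al p) (rowD X (fun q => conjr (E be q)) p).
  by rewrite bil_conj// conjrK -rowD_conj ?conjvK//; exact: E_rdiff.
rewrite rowD_orthonormal !conjc_mul r_real conji conjc_nat.
have -> : (form_eval (theta p) (conjv X))^*%C = form_eval (theta p) X.
  rewrite theta_eval// conjc_mul conji conjv2 pair_conj conjcK theta_CTM//.
  by rewrite mulrA mulNr ii_mul opprK mul1r.
rewrite (eq_sym be al); move: (bil _ _ _) (form_eval _ _) => x y.
by ring.
Qed.

(** Expand the (1,0) parts of [X] and [Y] in [E] and [xi]. The components along [E]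
    give the connection forms, since [E] is orthonormal; those along [xi] involve
    the derivative of [l (E_be) = 0], that is the antiholomorphic Hessian, which
    is the torsion. *)
Lemma unitary_structure X Y be : CTM rho p X -> CTM rho p Y ->
  dform (uth be) p X Y =
  \sum_al wedge_form (uth al p) (uomega al be p) X Y +
  \sum_al uA be al p * wedge_form (theta p) (conjv (uth al p)) X Y.
Proof.
move=> XT YT.
pose S X := (hess2 p (conjr X.2) (E be p))^*%C.
pose t X := form_eval (theta p) X.
pose e al X := form_eval (uth al p) X.
have F X' Y' : CTM rho p Y' -> form_eval (flatD X' (uth be) p) Y' =
    - \sum_al e al Y' * form_eval (uomega al be p) X'
    - 'i%C * r p * (e be Y' * t X' + t Y' * (S X' + e be X')).
  move=> YT'; rewrite form_evalE flatDE /=.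
  rewrite rowD_cst [X in _ + X]pairC pair0r addr0.
  have -> : rowD X' (fun q => conjr (E be q) *m a^T) p =
      rowD X' (fun q => conjr (E be q)) p *m a^T.
    apply/rowP => j; rewrite !mxE.
    rewrite (_ : (fun q => _) = (fun q => \sum_k conjr (E be q) 0 k * a^T k j)); last first.
      by apply/funext => q; rewrite mxE.
    have dE k : cdiff (fun q => conjr (E be q) 0 k) p := Ec_rdiff be k.
    rewrite vact_sum => [|k]; last by apply: cdiffM; [exact: dE|exact: cdiff_cst].
    apply: eq_bigr => k _; rewrite (vactM _ (dE k) (cdiff_cst _ _)) vact_cst.
    by rewrite mulr0 addr0 [rowD _ _ _ _ _]mxE mxE.
  rewrite pairM_tr [in LHS](E_expand Y'.1) bilDl bil_suml bilZl bil_xi//.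
  rewrite rowD_Ec_drow theta_CTM// -/(t Y') -/(S X').
  have -> : bil a X'.1 (conjr (E be p)) = e be X' by rewrite /e uth_eval.
  have -> : \sum_al bil a (bil a Y'.1 (conjr (E al p)) *: E al p)
       (rowD X' (fun q => conjr (E be q)) p) =
     - \sum_al e al Y' * form_eval (uomega al be p) X' - 'i%C * r p * (e be Y' * t X').
    rewrite -sumrN [X in _ = _ - X](_ : _ =
       \sum_al e al Y' * ('i%C * r p * (al == be)%:R * t X')).
      rewrite -sumrB; apply: eq_bigr => al _; rewrite bilZl rowD_orthonormal.
      rewrite uomega_eval -/(t X') /e uth_eval.
      by move: (bil _ _ _) (bil _ _ _) => x y; ring.
    rewrite (bigD1 be)//= big1 ?addr0 => [|al /negbTE ->]; last by rewrite mulr0 mul0r mulr0.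
    by rewrite eqxx mulr1; ring.
  by move: (\sum_al _) => s; ring.
have SE X' : S X' = \sum_al form_eval (conjv (uth al p)) X' *
      (hess2 p (E al p) (E be p))^*%C
    - 'i%C * t X' * (hess2 p (xi a (drow p)) (E be p))^*%C.
  rewrite /S [X in hess2 p X](E_expand (conjr X'.2)).
  have h2Dl x y z : hess2 p (x + y) z = hess2 p x z + hess2 p y z.
    rewrite /hess2 -big_split; apply: eq_bigr => j _; rewrite -big_split.
    by apply: eq_bigr => k _; rewrite /= mxE; ring.
  have h2Zl c x z : hess2 p (c *: x) z = c * hess2 p x z.
    rewrite /hess2 mulr_sumr; apply: eq_bigr => j _; rewrite mulr_sumr.
    by apply: eq_bigr => k _; rewrite mxE; ring.
  rewrite h2Dl h2Zl (big_morph (fun x => hess2 p x (E be p)) (id1 := 0) (op1 := +%R)) //;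
    last exact: hess20l.
  rewrite rmorphD rmorph_sum /=; congr (_ + _).
    by apply: eq_bigr => al _; rewrite h2Zl rmorphM /= uthc_eval.
  by rewrite rmorphM /= -pair_conj conjrK theta_eval2 mulNr.
rewrite /dform !F//.
have -> : \sum_al wedge_form (uth al p) (uomega al be p) X Y =
   \sum_al e al X * form_eval (uomega al be p) Y -
   \sum_al e al Y * form_eval (uomega al be p) X by rewrite -sumrB.
have -> : \sum_al uA be al p * wedge_form (theta p) (conjv (uth al p)) X Y =
   'i%C * r p * (t X * (\sum_al form_eval (conjv (uth al p)) Y *
      (hess2 p (E al p) (E be p))^*%C) - t Y * (\sum_al form_eval (conjv (uth al p)) X *
      (hess2 p (E al p) (E be p))^*%C)).
  rewrite !mulr_sumr -sumrB mulr_sumr; apply: eq_bigr => al _.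
  rewrite /uA /wedge_form -/(t X) -/(t Y).
  by move: (t X) (t Y) (hess2 _ _ _)^*%C (form_eval _ X) (form_eval _ Y) => *; ring.
rewrite !SE.
move: (\sum_al form_eval _ X * _) (\sum_al form_eval _ Y * _) => sX sY.
move: (\sum_al e al X * _) (\sum_al e al Y * _) => wX wY.
move: (t X) (t Y) (e be X) (e be Y) (r p) (hess2 p _ _)^*%C => tX tY eX eY r0 h0.
by ring.
Qed.

End Construction.

Section Assembly.
Variables (W : set (Cpoint R n)) (E : 'I_n -> Cpoint R n -> row).
Hypotheses (Wo : open W) (WU : W `<=` U).
Hypothesis drow0 : forall q, W q -> drow q != 0.
Hypothesis Es : forall al, rsmooth W (E al).
Hypothesis EE : forall al be q, W q -> bil a (E al q) (conjr (E be q)) = (al == be)%:R.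
Hypothesis El : forall al q, W q -> pairing (drow q) (E al q) = 0.

Lemma unitary_tanaka_webster :
  is_tanaka_webster U rho (i_dbar_rho rho) W (unitary_tw E).
Proof.
split.
- exact: (unitary_is_frame Wo WU Es EE El).
- exact: (unitary_is_Reeb Wo WU drow0).
- by move=> al; exact: (uth_smooth Wo Es).
- by move=> al be; exact: csmooth_cst.
- by move=> al be; exact: (uomega_smooth Wo WU drow0 Es).
- by move=> be al; exact: (uA_smooth Wo WU drow0 Es).
- by move=> p Wp Mp al be; exact: (unitary_dual EE El al be Wp Mp).
- by move=> p Wp Mp X Y XT YT; exact: (unitary_dtheta WU drow0 EE El Wp Mp XT YT).
- by move=> p Wp Mp X Y XT YT be; exact: (unitary_structure Wo WU drow0 Es EE El Wp Mp be XT YT).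
- by move=> p Wp Mp X XT al be; exact: (unitary_metric Wo WU Es EE Wp al be XT).
Qed.

Lemma unitary_frameP : is_unitary_frame U rho (i_dbar_rho rho) W (uZ E).
Proof.
split=> [|p Wp Mp al be]; first exact: (unitary_is_frame Wo WU Es EE El).
by rewrite dtheta_kahler// kahler_formE conjv2 /= bil0r subr0 EE.
Qed.

End Assembly.

Lemma open_nbhs_exists p (P : set (Cpoint R n)) : (\forall q \near p, P q) ->
  exists W : set (Cpoint R n), [/\ open W, W p & W `<=` P].
Proof.
move=> Pp; exists P^°.
by split; [exact: open_interior|exact: Pp|exact: interior_subset].
Qed.

Lemma near_Re_gt0 (W : set (Cpoint R n)) (f : Cpoint R n -> C) p : open W -> W p ->
  csmooth_on W f -> 0 < complex.Re (f p) ->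
  \forall q \near p, W q /\ 0 < complex.Re (f q).
Proof.
move=> Wo Wp [fs _] f0; have Wn : \forall q \near p, W q by exact: open_nbhs_nbhs.
have fc := differentiable_continuous (smooth_differentiable fs Wp).
have fn : \forall q \near p, 0 < complex.Re (f q) by exact: (cvgr_gt _ fc _ f0).
by apply: filterS2 Wn fn => q Wq fq.
Qed.

(** The unit vector [v] along the gradient of [rho] spans the orthogonal of the
    complex tangent space. Rotating its value [w] at [p] to its value at [q]
    carries a fixed orthonormal basis of the orthogonal of [w] to a unitary frame
    at [q]. *)
Lemma local_unitary_frame p : M p ->
  exists (W : set (Cpoint R n)) (E : 'I_n -> Cpoint R n -> row),
    [/\ open W, W p, W `<=` U,
      forall q, W q -> drow q != 0 &
      [/\ forall al, rsmooth W (E al),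
          forall al be q, W q -> bil a (E al q) (conjr (E be q)) = (al == be)%:R &
          forall al q, W q -> pairing (drow q) (E al q) = 0]].
Proof.
move=> Mp; have Up := M_U Mp.
pose g q := grad a (drow q); pose N q := grad2 a (drow q).
have N_real q : N q = (complex.Re (N q))%:C.
  have := grad2_real a_herm a_pos (drow q); rewrite -/(N q).
  case: (N q) => x y /= [] yy; congr (_ +i* _).
  by lra.
have N0 : 0 < complex.Re (N p).
  by apply: Re_gt0; apply: grad2_gt0 => //; exact: drow_neq0.
have [W1 [W1o W1p W1P]] := open_nbhs_exists
  (near_Re_gt0 U_open Up (csmooth_grad2 U_open (@subset_refl _ U)) N0).
have W1U : W1 `<=` U by move=> q /W1P[].
have W1N q : W1 q -> 0 < complex.Re (N q) by move=> /W1P[].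
pose s q := Num.sqrt (complex.Re (N q)).
have s0 q : W1 q -> 0 < s q by move=> Wq; rewrite sqrtr_gt0 W1N.
pose v q : row := ((s q)^-1)%:C *: g q.
have vs : rsmooth W1 v.
  apply: rsmoothZ => //; last exact: (rsmooth_grad W1o W1U).
  have sn0 q : W1 q -> s q != 0 by move=> Wq; rewrite gt_eqF// s0.
  have [Ns _] := csmooth_grad2 W1o W1U.
  exact: (csmooth_real W1o (smoothV W1o sn0 (smooth_sqrt W1o W1N Ns))).
have gg q : bil a (g q) (conjr (g q)) = N q by rewrite grad2_bil// grad2_real.
have cr (x : R) : (x%:C)^*%C = x%:C :> C by exact: conjc_real.
have vv q : W1 q -> bil a (v q) (conjr (v q)) = 1.
  move=> Wq; rewrite /v bilZl conjrZ bilZr cr gg N_real -!rmorphM /=.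
  rewrite -(sqr_sqrtr (ltW (W1N q Wq))) -/(s q).
  have := s0 q Wq; move: (s q) => x x0.
  by rewrite expr2 mulKf ?gt_eqF// mulVf ?gt_eqF// rmorph1.
pose w := v p; pose t q := 1 + bil a w (conjr (v q)).
have ts : csmooth_on W1 t.
  exact: (csmoothD W1o (csmooth_cst W1o 1)
    (csmooth_bil W1o a (rsmooth_cst W1o w) (rsmooth_conj W1o vs))).
have tp0 : 0 < complex.Re (t p) by rewrite /t /w vv//= addr_gt0.
(* Near [p] the denominator [t] of the rotation is close to [t p = 2]. *)
have [W [Wo Wp WP]] := open_nbhs_exists (near_Re_gt0 W1o W1p ts tp0).
have WW1 q : W q -> W1 q by move=> /WP[].
have Wt q : W q -> t q != 0.
  by move=> /WP[_]; apply: contraTneq => ->; rewrite ltxx.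
have [f [ff fw]] := orthonormal_exists a_herm a_pos w (leqnn n).
pose E al q := rotate a w (v q) (f al).
have ww : bil a w (conjr w) = 1 by exact: vv.
have sub y : rsmooth W1 y -> rsmooth W y.
  by move=> ys j; have [y1 y2] := ys j; split=> l q /WW1; [exact: y1|exact: y2].
have subc c : csmooth_on W1 c -> csmooth_on W c.
  by move=> [c1 c2]; split=> l q /WW1; [exact: c1|exact: c2].
exists W, E; split => //.
- by move=> q /WW1/W1U.
- move=> q /WW1 Wq; apply/eqP => d0; have := W1N q Wq.
  by rewrite /N /grad2 d0 pairC pair0r /= ltxx.
split.
- move=> al; have vsW := sub _ vs.
  have cs := csmoothM Wo (csmooth_bil Wo a (rsmooth_cst Wo (f al)) (rsmooth_conj Wo vsW))
    (csmoothV Wo Wt (subc _ ts)).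
  exact: (rsmoothD Wo (rsmooth_cst Wo (f al))
    (rsmoothN Wo (rsmoothZ Wo cs (rsmoothD Wo vsW (rsmooth_cst Wo w))))).
- move=> al be q Wq.
  by rewrite /E (rotate_isometry a_herm (vv q (WW1 q Wq)) ww (Wt q Wq))// ff.
- move=> al q Wq.
  have Ev : bil a (E al q) (conjr (v q)) = 0.
    exact: (rotate_orth (vv q (WW1 q Wq)) (Wt q Wq)).
  have sq0 : (s q)^-1 != 0 by rewrite invr_eq0 gt_eqF// s0//; exact: WW1.
  move: Ev; rewrite /v conjrZ cr bilZr => /eqP.
  rewrite mulf_eq0 => /orP[/eqP[] /eqP|/eqP].
    by rewrite (negbTE sq0).
  by rewrite -[LHS]conjcK bil_conj// conjrK bil_grad// pair_conj conjcK.
Qed.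

(** Apply the hypothesis to the data of [local_unitary_frame] and to the real field
    whose (1,0) part has constant components in [E] and the value [eta] at [p]. *)
Lemma pseudohermitian_convex_C_convex : (0 < n)%N ->
  pseudohermitian_C_convex U rho (i_dbar_rho rho) a -> C_convex U rho.
Proof.
move=> n0 pc p Mp eta; rewrite drow_sum => leta.
have [W [E [Wo Wp WU drow0 [Es EE El]]]] := local_unitary_frame Mp.
have tw := unitary_tanaka_webster Wo WU drow0 Es EE El.
have Eu := unitary_frameP Wo WU Es EE El.
pose c al := bil a eta (conjr (E al p)).
pose Z q : Cvec R n := (\sum_al c al *: E al q, 0).
pose X q := Z q + conjv (Z q).
have ZT q : W q -> T10M rho q (Z q).
  move=> Wq; split=> //; apply/CTME; first exact: WU.
  rewrite /= pair0r addr0 pair_sumr big1// => al _.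
  by rewrite pairZr El// mulr0.
have XM q : W q -> M q -> HM rho q (X q) by move=> Wq _; exists (Z q); [exact: ZT|].
have Z1s : rsmooth W (fun q => (Z q).1).
  by apply: rsmooth_sum => // al; apply: rsmoothZ => //; exact: csmooth_cst.
have Xs : vsmooth_on W X.
  apply: (@vsmooth_pair _ _ W (fun q => (Z q).1 + conjr 0) (fun q => 0 + conjr (Z q).1)).
    by apply: rsmoothD => //; exact: rsmooth_cst.
  by apply: rsmoothD => //; [exact: rsmooth_cst|exact: rsmooth_conj].
have := pc W Wo WU _ tw _ Eu X Xs XM p Wp Mp.
rewrite (h_formE Wo WU tw Wp Mp Eu n0 Xs XM (ZT p Wp) erefl).
rewrite pmulr_rge0; last exact: h_factor_gt0.
suff -> : (Z p).1 = eta by [].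
rewrite /= [RHS](orthonormal_expansion a_pos eta (drow0 p Wp) _ (fun al => El al p Wp)).
  by rewrite leta scale0r addr0.
by move=> al be; exact: EE.
Qed.

End Geometry.

(** * Equivalence of the two convexity conditions *)

Theorem proposition2p5 (R : realType) (n : nat) (hn : (1 <= n)%N)
    (U : set (Cpoint R n)) (rho : Cpoint R n -> R) (a : 'M[R[i]]_n.+1)
    (U_open : open U) (rho_smooth : smooth_on U rho)
    (drho_neq0 : forall p, hypersurface U rho p -> exists v, 'd rho p v != 0)
    (spc : strictly_pseudoconvex U rho)
    (a_herm : forall j k, a j k = (a k j)^*%C)
    (a_posdef : forall v : 'rV[R[i]]_n.+1, v != 0 ->
       0 < \sum_j \sum_k a j k * v 0 j * (v 0 k)^*%C)
    (rho_a : complex_hessian_o U rho a) :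
  semi_isometric U rho (i_dbar_rho rho) a /\
  (C_convex U rho <-> pseudohermitian_C_convex U rho (i_dbar_rho rho) a).
Proof.
have a_pos v : v != 0 -> 0 < bil a v (conjr v).
  move=> /a_posdef; rewrite /bil.
  by under [X in _ -> _ < X]eq_bigr do under eq_bigr do rewrite mxE.
split=> [p Mp X Y _ _|].
  exact: (dtheta_kahler U_open rho_smooth drho_neq0 a_herm rho_a).
split.
- exact: (C_convex_pseudohermitian_convex U_open rho_smooth drho_neq0 a_herm rho_a a_pos hn).
- exact: (pseudohermitian_convex_C_convex U_open rho_smooth drho_neq0 a_herm rho_a a_pos hn).
Qed.
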